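(* Let $d\ge1$ and let $(\mathbf X_t)_{t\ge0}$ be a stationary random walk Metropolis--Hastings (RWMH) chain on $\mathbb R^d$ with target density $\pi$ and proposal step-density $\phi$ (both with respect to Lebesgue measure). Suppose that $\pi(\mathbf x)=\hat\pi(\|\mathbf x\|)$ for some nonincreasing function $\hat\pi$ on $[0,\infty)$ and that $\phi$ is symmetric about $\mathbf 0$. If $\mathbf X_0\in L^2$, then $$\operatorname{trCorr}(\mathbf X_0,\mathbf X_1)>\tfrac19.$$
   Context: RWMH chain: $\pi$ and $\phi$ are probability densities on $\mathbb R^d$ with respect to Lebesgue measure. Set $q(\mathbf x,\mathbf y)=\phi(\mathbf y-\mathbf x)$ and $$\alpha(\mathbf x,\mathbf y)=\begin{cases}\min\{1,\ \pi(\mathbf y)q(\mathbf y,\mathbf x)/(\pi(\mathbf x)q(\mathbf x,\mathbf y))\},&\pi(\mathbf x)q(\mathbf x,\mathbf y)>0,\\ 1,&\pi(\mathbf x)q(\mathbf x,\mathbf y)=0.\end{cases}$$ From state $\mathbf x$, the Markov chain proposes $\mathbf y$ drawn from the density $q(\mathbf x,\cdot)$, moves to $\mathbf y$ with probability $\alpha(\mathbf x,\mathbf y)$, and otherwise stays at $\mathbf x$. The chain is stationary: $\mathbf X_0$ (hence every $\mathbf X_t$) has density $\pi$. ''$\phi$ symmetric'' means $\phi(-\mathbf z)=\phi(\mathbf z)$ for $\mathbf z\in\mathbb R^d$. $\|\cdot\|$ is the Euclidean norm, and $\mathbf X_0\in L^2$ means $\mathbb E\|\mathbf X_0\|^2<\infty$.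 For random vectors $\mathbf Y,\tilde{\mathbf Y}\in L^2$ in $\mathbb R^d$: $\operatorname{trCov}(\mathbf Y,\tilde{\mathbf Y})=\sum_{i=1}^d\operatorname{Cov}(Y_i,\tilde Y_i)$, $\operatorname{trVar}\mathbf Y=\operatorname{trCov}(\mathbf Y,\mathbf Y)$, and, when neither vector is degenerate, $\operatorname{trCorr}(\mathbf Y,\tilde{\mathbf Y})=\operatorname{trCov}(\mathbf Y,\tilde{\mathbf Y})/\big((\operatorname{trVar}\mathbf Y)^{1/2}(\operatorname{trVar}\tilde{\mathbf Y})^{1/2}\big)$. *)

(* Defs.v *)
From HB Require Import structures.
From mathcomp Require Import all_boot all_order all_algebra.
From mathcomp Require Import all_classical reals ereal topology normedtype.
From mathcomp Require Import sequences measure lebesgue_measure.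
From mathcomp Require Import lebesgue_integral probability.

Set Implicit Arguments.
Unset Strict Implicit.
Unset Printing Implicit Defensive.
Import Order.TTheory GRing.Theory Num.Theory.
Local Open Scope classical_set_scope.
Local Open Scope ring_scope.

Section euclidean.
Context {R : realType} {d : nat}.
Implicit Types x y : d.-tuple R.

Definition topp x : d.-tuple R := [tuple - tnth x i | i < d].

Definition tsub x y : d.-tuple R := [tuple tnth x i - tnth y i | i < d].

Definition enorm x : R := Num.sqrt (\sum_(i < d) tnth x i ^+ 2).

End euclidean.

(* Lebesgue measure on the Borel sets of R^d, where R^d is [d.-tuple R] with
   its product sigma-algebra. It is the d-fold product of the Lebesgue measure
   on R: a point mass for d = 0, and for d + 1 the image of the product of the
   one-dimensional and the d-dimensional measures under (x, v) |-> x :: v.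
   [lebesgue_tuple_box] below gives its value on boxes. *)
Section lebesgue_tuple.
Context {R : realType}.

Definition tcons n (xv : measurableTypeR R * n.-tuple R) : n.+1.-tuple R :=
  [tuple of xv.1 :: xv.2].

Lemma measurable_tcons n : measurable_fun [set: _] (@tcons n).
Proof.
exact: (@measurable_cons _ _ _ _ (fst : measurableTypeR R * n.-tuple R -> R) n
  (snd : measurableTypeR R * n.-tuple R -> n.-tuple R)).
Qed.

Section step.
Variables (n : nat) (mu : {sigma_finite_measure set (n.-tuple R) -> \bar R}).

Definition lebesgue_step : set (n.+1.-tuple R) -> \bar R :=
  pushforward (@lebesgue_measure R \x mu)%E (@tcons n).

Let mtcons := @measurable_tcons n.

Let lebesgue_step0 : lebesgue_step set0 = 0%E.
Proof. exact: measure0. Qed.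

Let lebesgue_step_ge0 A : (0 <= lebesgue_step A)%E.
Proof. exact: measure_ge0. Qed.

Let lebesgue_step_sigma_additive : semi_sigma_additive lebesgue_step.
Proof. exact: measure_semi_sigma_additive. Qed.

HB.instance Definition _ := isMeasure.Build _ _ _ lebesgue_step
  lebesgue_step0 lebesgue_step_ge0 lebesgue_step_sigma_additive.

Let lebesgue_step_sigma_finite : sigma_finite setT lebesgue_step.
Proof.
have /sigma_finiteP[F [TF ndF mF]] := sigma_finiteT (@lebesgue_measure R).
have /sigma_finiteP[G [TG ndG mG]] := sigma_finiteT mu.
pose h (v : n.+1.-tuple R) : measurableTypeR R * n.-tuple R :=
  (thead v, [tuple of behead v]).
have tK : cancel (@tcons n) h.
  move=> [x v]; rewrite /h /tcons /thead /= tnth0.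
  by congr pair; exact/val_inj.
have mh : measurable_fun setT h.
  apply/measurable_fun_pairP; split; first exact: measurable_tnth.
  apply/measurable_fun_tnthP => i.
  rewrite (_ : _ \o _ = @tnth _ R ^~ (lift ord0 i)); first exact: measurable_tnth.
  apply/funext => v /=; rewrite [in RHS](tuple_eta v) tnthS; congr tnth.
exists (fun k => h @^-1` (F k `*` G k)).
  apply/seteqP; split => // v _.
  have [a _ Fa] : (\bigcup_k F k) (h v).1 by rewrite -TF.
  have [b _ Gb] : (\bigcup_k G k) (h v).2 by rewrite -TG.
  exists (maxn a b) => //; split => /=.
  - by move: Fa; exact/subsetPset/ndF/leq_maxl.
  - by move: Gb; exact/subsetPset/ndG/leq_maxr.
move=> k; have [mFk Fk] := mF k; have [mGk Gk] := mG k; split.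
  by rewrite -[X in measurable X]setTI; apply: mh => //; exact: measurableX.
rewrite /lebesgue_step /pushforward -comp_preimage.
rewrite (_ : h \o _ = id) ?preimage_id; last by apply/funext => xv; exact: tK.
by rewrite product_measure1E// lte_mul_pinfty// ge0_fin_numE.
Qed.

HB.instance Definition _ := Measure_isSigmaFinite.Build _ _ _ lebesgue_step
  lebesgue_step_sigma_finite.

End step.

Fixpoint lebesgue_tuple (d : nat) :
    {sigma_finite_measure set (d.-tuple R) -> \bar R} :=
  if d is n.+1 then lebesgue_step (lebesgue_tuple n) else \d_([tuple]).

Lemma lebesgue_tuple_box d (A : 'I_d -> set R) :
    (forall i, measurable (A i)) ->
  lebesgue_tuple d [set x | forall i, A i (tnth x i)] =
  (\prod_(i < d) (@lebesgue_measure R) (A i))%E.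
Proof.
elim: d A => [|d IH] A mA.
  by rewrite big_ord0 /= diracE mem_set//= => -[].
rewrite big_ord_recl -IH; last by move=> i; exact: mA.
rewrite /= /lebesgue_step /pushforward -product_measure1E//; last 2 first.
- exact: mA.
- rewrite (_ : mkset _ =
    \bigcap_(i in [set: 'I_d]) ((@tnth _ R ^~ i) @^-1` A (lift ord0 i))).
    apply: fin_bigcap_measurable => [|i _]; first exact: finite_finset.
    rewrite -[X in measurable X]setTI.
    by apply: measurable_tnth => //; exact: mA.
  by apply/seteqP; split => x /= H i; [move=> _; exact: H|exact: H].
congr (_ _); apply/seteqP; split => [[x v]/= H|[x v]/= [Hx Hv] i].
  split => [|i]; first by have := H ord0; rewrite tnth0.
  by have := H (lift ord0 i); rewrite tnthS.
by case: (unliftP ord0 i) => [j ->|->]; rewrite ?tnth0 ?tnthS//; exact: Hv.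
Qed.

End lebesgue_tuple.

Section densities.
Context {R : realType} {d : nat}.
Local Open Scope ereal_scope.

Definition is_density (f : d.-tuple R -> R) :=
  [/\ measurable_fun setT f, forall x, (0 <= f x)%R &
      \int[lebesgue_tuple d]_x (f x)%:E = 1].

Definition has_density {disp} {T : measurableType disp} (P : probability T R)
    (Y : {RV P >-> d.-tuple R}) (f : d.-tuple R -> R) :=
  forall A, measurable A ->
    distribution P Y A = \int[lebesgue_tuple d]_(x in A) (f x)%:E.

End densities.

Section rwmh.
Context {R : realType} {d : nat}.
Variables pi phi : d.-tuple R -> R.

Definition proposal (x y : d.-tuple R) : R := phi (tsub y x).

Definition acceptance (x y : d.-tuple R) : R :=
  if 0 < pi x * proposal x y
  then Num.min 1 (pi y * proposal y x / (pi x * proposal x y))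
  else 1.

(* One step from x: an accepted proposal landing in B, or a rejection, after
   which the chain is still at x. *)
Definition rwmh_kernel (x : d.-tuple R) (B : set (d.-tuple R)) : \bar R :=
  (\int[lebesgue_tuple d]_(y in B) (proposal x y * acceptance x y)%:E
   + (\int[lebesgue_tuple d]_y (proposal x y * (1 - acceptance x y))%:E)
     * \d_x B)%E.

(* The Markov property P(X_{t+1} in B | X_0, ..., X_t) = rwmh_kernel X_t B,
   spelled out on the sigma-algebra generated by X_0, ..., X_t. *)
Definition is_rwmh_chain {disp} {T : measurableType disp} (P : probability T R)
    (X : nat -> {RV P >-> d.-tuple R}) :=
  forall (t : nat) (E : set T) (B : set (d.-tuple R)),
    g_sigma_preimage (fun s : 'I_t.+1 => X s : T -> d.-tuple R) E ->
    measurable B ->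
    P (E `&` X t.+1 @^-1` B) = (\int[P]_(w in E) rwmh_kernel (X t w) B)%E.

Definition is_stationary_rwmh_chain {disp} {T : measurableType disp}
    (P : probability T R) (X : nat -> {RV P >-> d.-tuple R}) :=
  has_density (X 0%N) pi /\ is_rwmh_chain X.

End rwmh.

Section trace_correlation.
Context {R : realType} {d : nat} {disp} {T : measurableType disp}.
Variable P : probability T R.
Implicit Types Y Z : {RV P >-> d.-tuple R}.
Local Open Scope ereal_scope.

Definition square_integrable Y := 'E_P[fun w => (enorm (Y w) ^+ 2)%R] < +oo.

Definition trCov Y Z : \bar R :=
  \sum_(i < d) covariance P (fun w => tnth (Y w) i) (fun w => tnth (Z w) i).

Definition trVar Y : \bar R := trCov Y Y.

(* Meaningful for square-integrable, non-degenerate Y and Z, where both traces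
   are finite and the denominator is positive; otherwise [fine] and division by
   zero return default values. *)
Definition trCorr Y Z : R :=
  (fine (trCov Y Z) /
   (Num.sqrt (fine (trVar Y)) * Num.sqrt (fine (trVar Z))))%R.

End trace_correlation.

(* Main.v *)
From HB Require Import structures.
Require Import Defs.
From mathcomp Require Import all_boot all_order all_algebra.
From mathcomp Require Import all_classical reals ereal topology normedtype.
From mathcomp Require Import sequences measure lebesgue_measure.
From mathcomp Require Import lebesgue_integral probability.
From mathcomp Require Import measurable_realfun numfun charge exp derive realfun.
From mathcomp Require Import ftc lra ring.
Set Implicit Arguments.
Unset Strict Implicit.
Unset Printing Implicit Defensive.
Import Order.TTheory GRing.Theory Num.Theory.
Import numFieldNormedType.Exports.
Local Open Scope classical_set_scope.
Local Open Scope ring_scope.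

(** Since pi is even, X_0 and X_1 have mean zero, and X_1 has the same law as
    X_0 by reversibility. With M = E|X_0|^2 this turns trCorr(X_0, X_1) into
    1 - E|X_1 - X_0|^2 / (2 M) ([trCov_polarization]), so the claim is that
    E|X_1 - X_0|^2 < (16/9) M. Because phi is symmetric, accepted moves from x
    to y have joint density phi(y - x) min(pi x, pi y), whence E|X_1 - X_0|^2
    is the phi-average over z of
      overlap z = |z|^2 * int min(pi x, pi (x + z)) dx
    ([integral_jump]). It is therefore enough to show overlap z < (16/9) M for
    almost every z ([overlap_lt_ae]).

    Fix z and slice space into lines parallel to z. If u measures position on
    such a line from its point nearest to the origin, pi is there a
    nonincreasing function gamma of |u|, while |x|^2 is u^2 plus the squared
    distance from the line to the origin. Everything thus reduces to one
    dimension ([shifted_overlap_le]):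
      h^2 * int min(gamma|u|, gamma|u + h|) du <= (16/9) int u^2 gamma|u| du.
    The minimum equals gamma(|u + h/2| + |h|/2), so the integral on the left
    is that of gamma|v| over |v| >= |h|/2, and the inequality reads
    int gamma|v| k(v) dv >= 0 for the kernel
      k(v) = (16/9) v^2 - h^2 1{|v| >= |h|/2}.
    As |v| grows, k is positive up to |h|/2, negative up to 3|h|/4, positive
    afterwards, and its integral over |v| <= 3|h|/4 is zero: 16/9 is the
    constant for which the last two facts hold together. A nonincreasing gamma
    hence satisfies int gamma k >= gamma(|h|/2) int_{|v| <= 3|h|/4} k = 0.

    Strictness has two sources. In dimension at least two almost every line
    misses the origin, and the squared distance dropped above is positive
    ([overlap_lt]). In dimension one, equality forces gamma to be constant up
    to 3|h|/4 and zero beyond, so it can hold for one value of |h| only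
    ([no_two_extremal_shifts]), and a density does not charge two points.

    The slicing is done without rotations. For z = (h, zeta) with h <> 0, the
    lines are a |-> (a, w + (a/h) zeta), a shear of the lines parallel to the
    first axis; Fubini and translation invariance are all that is needed, and
    the z with h = 0 form a null set ([ge0_integral_shear]). *)

(** * Integrals of nonnegative functions *)

Section density.
Local Open Scope ereal_scope.
Context d (T : measurableType d) (R : realType).
Variables (mu nu : {measure set T -> \bar R}) (f : T -> R).
Hypotheses (mf : measurable_fun setT f) (f0 : forall x, (0 <= f x)%R).
Hypothesis nuE : forall A, measurable A -> nu A = \int[mu]_(x in A) (f x)%:E.

Import HBNNSimple.

Let integral_density_nnsfun (g : {nnsfun T >-> R}) :
  \int[nu]_x (g x)%:E = \int[mu]_x ((g x)%:E * (f x)%:E).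
Proof.
under [LHS]eq_integral do rewrite fimfunE -fsumEFin//.
rewrite [LHS]ge0_integral_fsum//; last 2 first.
  - by move=> r; exact/measurable_EFinP/measurableT_comp.
  - by move=> n x _; rewrite EFinM nnfun_muleindic_ge0.
under [RHS]eq_integral.
  move=> x xD; rewrite fimfunE -fsumEFin// muleC ge0_mule_fsumr; last first.
    by move=> r; rewrite EFinM nnfun_muleindic_ge0.
  over.
rewrite [RHS]ge0_integral_fsum//; last 2 first.
  - move=> r; apply: emeasurable_funM; first exact/measurable_EFinP.
    exact/measurable_EFinP/measurableT_comp.
  - by move=> n x _; rewrite mule_ge0 ?lee_fin// -lee_fin EFinM nnfun_muleindic_ge0.
apply: eq_fsbigr => r _.
have [r0|r0] := ltP r 0%R.
  rewrite preimage_nnfun0// !integral0_eq// => x _.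
  - by rewrite indicE in_set0 mulr0 mule0.
  - by rewrite indicE in_set0 mulr0.
rewrite integralZl_indic_nnsfun//= integral_indic// setIT nuE//.
rewrite -ge0_integralZl//; last 2 first.
  - exact/measurable_EFinP/measurable_funTS.
  - by move=> x _; rewrite lee_fin.
rewrite [LHS]integral_mkcond; apply: eq_integral => x _.
rewrite patchE indicE; case: ifPn => _.
  by rewrite mulr1 muleC.
by rewrite mulr0 mule0.
Qed.

(** Equality of the measures on sets passes to simple functions, then to the
    monotone limit. Used for the law of X_0 and for the law of the accepted
    moves, whose total mass is not 1. *)
Lemma ge0_integral_density (h : T -> \bar R) :
  measurable_fun setT h -> (forall x, 0 <= h x) ->
  \int[nu]_x h x = \int[mu]_x (h x * (f x)%:E).
Proof.
move=> mh h0.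
pose h_ := nnsfun_approx measurableT mh.
transitivity (lim (\int[nu]_x (h_ n x)%:E @[n --> \oo])).
  rewrite -monotone_convergence//=.
  - apply: eq_integral => ? /[!inE] xD; apply/esym/cvg_lim => //=.
    exact: cvg_nnsfun_approx.
  - by move=> n; exact/measurable_EFinP/measurable_funTS.
  - by move=> n ? _; rewrite lee_fin.
  - by move=> ? _ ? ? mn; rewrite lee_fin; exact/lefP/nd_nnsfun_approx.
transitivity (lim (\int[mu]_x ((h_ n x)%:E * (f x)%:E) @[n --> \oo])).
  by apply: congr_lim; apply/funext => n; exact: integral_density_nnsfun.
rewrite -monotone_convergence//=.
- apply: eq_integral => x _; apply/cvg_lim => //.
  have hx : (h_ n x)%:E @[n --> \oo] --> h x by exact: cvg_nnsfun_approx.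
  exact: cvgeZr.
- move=> n; apply: emeasurable_funM; last exact/measurable_EFinP.
  exact/measurable_EFinP/measurable_funTS.
- by move=> n x _; rewrite mule_ge0 ?lee_fin.
- move=> x _ m n mn; rewrite lee_wpmul2r ?lee_fin//.
  exact/lefP/nd_nnsfun_approx.
Qed.

End density.

Lemma ge0_integral_pushforwardT d1 d2 (X : measurableType d1)
    (Y : measurableType d2) (R : realType) (phi : X -> Y)
    (mu : {measure set X -> \bar R}) (nu : {measure set Y -> \bar R}) :
  measurable_fun setT phi ->
  (forall A, measurable A -> pushforward mu phi A = nu A) ->
  forall f : Y -> \bar R, measurable_fun setT f -> (forall y, (0 <= f y)%E) ->
  (\int[mu]_x f (phi x) = \int[nu]_y f y)%E.
Proof.
move=> mphi munu f mf f0.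
have := ge0_integral_pushforward mphi mu measurableT mf (fun y _ => f0 y).
rewrite preimage_setT => <-.
by apply: eq_measure_integral => A mA _; exact: munu.
Qed.

Section lebesgue_measure_invariance.
Local Open Scope ereal_scope.
Context {R : realType}.
Local Notation mu := (@lebesgue_measure R).

Lemma measurable_addr (a : R) :
  measurable_fun [set: measurableTypeR R]
    (fun x => x + a : measurableTypeR R)%R.
Proof. exact: measurable_funD. Qed.

(** Lebesgue measure is determined by its values on half-open intervals. *)
Lemma lebesgue_measureD (a : R) (A : set (measurableTypeR R)) :
  measurable A ->
  pushforward mu (fun x : measurableTypeR R => x + a : measurableTypeR R)%R A =
  mu A.
Proof.
move=> mA; apply/esym/lebesgue_measure_unique => //=.
  exact: measurable_addr.
move=> _ _ [[b c]] _ <-.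
rewrite /pushforward.
rewrite (_ : _ @^-1` _ = `]b - a, c - a]%classic)%R; last first.
  by apply/seteqP; split => x/=; rewrite !in_itv/= ltrBlDr lerBrDr.
rewrite !lebesgue_measure_itv/= !lte_fin ltrD2r.
by case: ifPn => // _; rewrite -!EFinD; congr EFin; lra.
Qed.

Lemma ge0_integral_shift (a : R) (f : measurableTypeR R -> \bar R) :
  measurable_fun setT f -> (forall x, 0 <= f x) ->
  \int[mu]_x f (x + a)%R = \int[mu]_x f x.
Proof.
apply: ge0_integral_pushforwardT (measurable_addr a) _ f.
exact: lebesgue_measureD.
Qed.

Lemma ge0_integral_reflect (f : measurableTypeR R -> \bar R) :
  measurable_fun setT f -> (forall x, 0 <= f x) ->
  \int[mu]_x f (- x)%R = \int[mu]_x f x.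
Proof.
apply: (ge0_integral_pushforwardT (phi := -%R : measurableTypeR R -> measurableTypeR R)) f.
  exact: measurable_funN.
exact: lebesgue_measureN.
Qed.

End lebesgue_measure_invariance.

Section ge0_real_integrals.
Local Open Scope ereal_scope.
Context d (T : measurableType d) (R : realType).
Variable mu : {measure set T -> \bar R}.
Implicit Types f g : T -> R.

Lemma ge0_integralZl_real f k : measurable_fun setT f ->
  (forall x, 0 <= f x)%R -> (0 <= k)%R ->
  \int[mu]_x (k * f x)%:E = k%:E * \int[mu]_x (f x)%:E.
Proof.
move=> mf f0 k0; rewrite -ge0_integralZl//; first exact/measurable_EFinP.
by move=> x _; rewrite lee_fin.
Qed.

Lemma ge0_integralD_real f g :
  measurable_fun setT f -> (forall x, 0 <= f x)%R ->
  measurable_fun setT g -> (forall x, 0 <= g x)%R ->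
  \int[mu]_x (f x + g x)%:E = \int[mu]_x (f x)%:E + \int[mu]_x (g x)%:E.
Proof.
move=> mf f0 mg g0; rewrite -ge0_integralD//.
- by move=> x _; rewrite lee_fin.
- exact/measurable_EFinP.
- by move=> x _; rewrite lee_fin.
- exact/measurable_EFinP.
Qed.

Lemma ge0_le_integral_real f g :
  measurable_fun setT f -> (forall x, 0 <= f x)%R ->
  measurable_fun setT g -> (forall x, f x <= g x)%R ->
  \int[mu]_x (f x)%:E <= \int[mu]_x (g x)%:E.
Proof.
move=> mf f0 mg fg; apply: ge0_le_integral => //.
- by move=> x _; rewrite lee_fin.
- exact/measurable_EFinP.
- exact/measurable_EFinP.
- by move=> x _; rewrite lee_fin.
Qed.

Lemma ge0_integral_real f : (forall x, 0 <= f x)%R -> 0 <= \int[mu]_x (f x)%:E.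
Proof. by move=> f0; apply: integral_ge0 => x _; rewrite lee_fin. Qed.

End ge0_real_integrals.

Section integral_eq0.
Local Open Scope ereal_scope.
Context d (T : measurableType d) (R : realType).
Variable mu : {measure set T -> \bar R}.

Lemma ge0_integral_eq0_ae (f : T -> \bar R) : measurable_fun setT f ->
  (forall x, 0 <= f x) ->
  \int[mu]_x f x = 0 <-> {ae mu, forall x, f x = 0}.
Proof.
move=> mf f0; rewrite (eq_integral (fun x => `|f x|)); last first.
  by move=> x _; rewrite gee0_abs.
split.
- by move/(ae_eq_integral_abs _ measurableT mf).1; apply: filterS => x /(_ I).
- move=> f1; apply/(ae_eq_integral_abs _ measurableT mf).2.
  by apply: filterS f1 => x /=.
Qed.

End integral_eq0.

Section density_measure.
Local Open Scope ereal_scope.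
Context d (T : measurableType d) (R : realType).
Variables (mu : {measure set T -> \bar R}) (f : T -> \bar R).
Hypotheses (mf : measurable_fun setT f) (f0 : forall x, 0 <= f x).

(** The two proofs are arguments so that the measure structure can be attached
    to the set function itself. *)
Definition density_measure of measurable_fun setT f & (forall x, 0 <= f x) :=
  fun A => \int[mu]_(x in A) f x.

Local Notation nu := (density_measure mf f0).

Let nu0 : nu set0 = 0. Proof. exact: integral_set0. Qed.

Let nu_ge0 A : 0 <= nu A. Proof. exact: integral_ge0. Qed.

Let nu_sigma_additive : semi_sigma_additive nu.
Proof. exact: semi_sigma_additive_nng_induced. Qed.

HB.instance Definition _ := isMeasure.Build _ _ _ nu
  nu0 nu_ge0 nu_sigma_additive.

End density_measure.

Section image_measure.
Local Open Scope ereal_scope.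
Context d1 d2 (X : measurableType d1) (Y : measurableType d2) (R : realType).
Variables (mu : {measure set X -> \bar R}) (f : X -> Y).
Hypothesis mf : measurable_fun setT f.

Definition image_measure of measurable_fun setT f := pushforward mu f.

Local Notation nu := (image_measure mf).

Let nu0 : nu set0 = 0. Proof. exact: measure0. Qed.

Let nu_ge0 A : 0 <= nu A. Proof. exact: measure_ge0. Qed.

Let nu_sigma_additive : semi_sigma_additive nu.
Proof. exact: measure_semi_sigma_additive. Qed.

HB.instance Definition _ := isMeasure.Build _ _ _ nu
  nu0 nu_ge0 nu_sigma_additive.

Lemma ge0_integral_image_measure (h : Y -> \bar R) :
  measurable_fun setT h -> (forall y, 0 <= h y) ->
  \int[nu]_y h y = \int[mu]_x h (f x).
Proof. by move=> mh h0; apply/esym; apply: ge0_integral_pushforwardT. Qed.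

End image_measure.

(** Rectangles form a pi-system generating the product sigma-algebra, and
    finiteness on the whole space makes the pi-lambda argument apply. This
    pins down the joint law of (X_0, X_1), of which the Markov property only
    gives the values on rectangles. *)
Lemma measure_eq_rectangles d1 d2 (T1 : measurableType d1)
    (T2 : measurableType d2) (R : realType)
    (m1 m2 : {measure set (T1 * T2) -> \bar R}) :
  (m1 setT < +oo)%E ->
  (forall A B, measurable A -> measurable B -> m1 (A `*` B) = m2 (A `*` B)) ->
  forall C, measurable C -> m1 C = m2 C.
Proof.
move=> m1oo m12 C mC.
pose G : set (set (T1 * T2)) :=
  [set A `*` B | A in measurable & B in measurable].
apply: (measure_unique G (fun=> setT)) => //.
- by rewrite measurable_prod_measurableType.
- move=> _ _ [A1 mA1 [B1 mB1 <-]] [A2 mA2 [B2 mB2 <-]].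
  exists (A1 `&` A2); first exact: measurableI.
  by exists (B1 `&` B2); [exact: measurableI|rewrite setXI].
- by move=> _; exists setT => //; exists setT => //; rewrite setXTT.
- by apply/seteqP; split => // x _; exists 0%N.
- by move=> _ [A mA [B mB <-]]; exact: m12.
Qed.

(** * Lebesgue measure on tuples *)
Definition tadd {R : realType} {d : nat} (x y : d.-tuple R) : d.-tuple R :=
  [tuple tnth x i + tnth y i | i < d].

Definition tscale {R : realType} {d : nat} (c : R) (x : d.-tuple R) :
  d.-tuple R := [tuple c * tnth x i | i < d].

Definition sqnorm {R : realType} {d : nat} (x : d.-tuple R) : R :=
  \sum_(i < d) tnth x i ^+ 2.

Section lebesgue_tuple_invariance.
Local Open Scope ereal_scope.
Context {R : realType}.
Local Notation mu := (@lebesgue_measure R).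
Local Notation lam := (@lebesgue_tuple R _).

Lemma tnth_tcons0 n (a : R) (v : n.-tuple R) : tnth (tcons (a, v)) ord0 = a.
Proof. by rewrite tnth0. Qed.

Lemma tnth_tconsS n (a : R) (v : n.-tuple R) i :
  tnth (tcons (a, v)) (lift ord0 i) = tnth v i.
Proof. by rewrite tnthS. Qed.

Lemma tconsP n (x : n.+1.-tuple R) : exists a v, x = tcons (a, v).
Proof.
exists (thead x), [tuple of behead x]; rewrite [LHS]tuple_eta; exact/val_inj.
Qed.

Lemma eq_tcons n (x : n.+1.-tuple R) a v :
  tnth x ord0 = a -> (forall i, tnth x (lift ord0 i) = tnth v i) ->
  x = tcons (a, v).
Proof.
move=> xa xv; apply: eq_from_tnth => i.
by case: (unliftP ord0 i) => [j ->|->]; rewrite ?tnth_tcons0 ?tnth_tconsS.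
Qed.

Lemma tadd_tcons n (a b : R) (v w : n.-tuple R) :
  tadd (tcons (a, v)) (tcons (b, w)) = tcons (a + b, tadd v w)%R.
Proof.
apply: eq_tcons => [|i]; first by rewrite tnth_mktuple !tnth_tcons0.
by rewrite !tnth_mktuple !tnth_tconsS.
Qed.

Lemma topp_tcons n (a : R) (v : n.-tuple R) :
  topp (tcons (a, v)) = tcons (- a, topp v)%R.
Proof.
apply: eq_tcons => [|i]; first by rewrite tnth_mktuple !tnth_tcons0.
by rewrite !tnth_mktuple !tnth_tconsS.
Qed.

Lemma measurable_tnth_comp dd (T : measurableType dd) n (f : T -> n.-tuple R) i :
  measurable_fun setT f -> measurable_fun setT (fun x => tnth (f x) i).
Proof. by move/measurable_fun_tnthP/(_ i). Qed.

Lemma measurable_tadd dd (T : measurableType dd) n (f g : T -> n.-tuple R) :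
  measurable_fun setT f -> measurable_fun setT g ->
  measurable_fun setT (fun x => tadd (f x) (g x)).
Proof.
move=> mf mg; apply/measurable_fun_tnthP => i.
rewrite (_ : _ \o _ = fun x => tnth (f x) i + tnth (g x) i)%R; last first.
  by apply/funext => x /=; rewrite tnth_mktuple.
by apply: measurable_funD; exact: measurable_tnth_comp.
Qed.

Lemma measurable_tsub dd (T : measurableType dd) n (f g : T -> n.-tuple R) :
  measurable_fun setT f -> measurable_fun setT g ->
  measurable_fun setT (fun x => tsub (f x) (g x)).
Proof.
move=> mf mg; apply/measurable_fun_tnthP => i.
rewrite (_ : _ \o _ = fun x => tnth (f x) i - tnth (g x) i)%R; last first.
  by apply/funext => x /=; rewrite tnth_mktuple.
by apply: measurable_funB; exact: measurable_tnth_comp.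
Qed.

Lemma measurable_topp n : measurable_fun setT (@topp R n).
Proof.
apply/measurable_fun_tnthP => i.
rewrite (_ : _ \o _ = fun x => - tnth x i)%R; last first.
  by apply/funext => x /=; rewrite tnth_mktuple.
by apply: measurable_funN => //; exact: measurable_tnth.
Qed.

Lemma measurable_tscale dd (T : measurableType dd) n (c : T -> R)
    (f : T -> n.-tuple R) :
  measurable_fun setT c -> measurable_fun setT f ->
  measurable_fun setT (fun x => tscale (c x) (f x)).
Proof.
move=> mc mf; apply/measurable_fun_tnthP => i.
rewrite (_ : _ \o _ = fun x => c x * tnth (f x) i)%R; last first.
  by apply/funext => x /=; rewrite tnth_mktuple.
by apply: measurable_funM => //; exact: measurable_tnth_comp.
Qed.

Lemma measurable_sqnorm dd (T : measurableType dd) n (f : T -> n.-tuple R) :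
  measurable_fun setT f -> measurable_fun setT (fun x => sqnorm (f x)).
Proof.
move=> mf; apply: measurable_sum => i.
by apply: measurable_funX; exact: measurable_tnth_comp.
Qed.

Lemma ge0_integral_tcons n (F : n.+1.-tuple R -> \bar R) :
  measurable_fun setT F -> (forall x, 0 <= F x) ->
  \int[lam]_x F x = \int[mu]_a \int[lam]_v F (tcons (a, v)).
Proof.
move=> mF F0.
rewrite -(fubini_tonelli1 (F \o @tcons R n)); last 2 first.
- by apply: measurableT_comp => //; exact: measurable_tcons.
- by move=> x; exact: F0.
by apply/esym; apply: ge0_integral_pushforwardT mF F0 => //; exact: measurable_tcons.
Qed.

Lemma measurable_tcons_slice n (a : R) :
  measurable_fun setT (fun v : n.-tuple R => tcons (a, v)).
Proof.
apply: measurable_cons => /=; first exact: measurable_cst.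
exact: measurable_id.
Qed.

Lemma measurable_tcons_line n (v : n.-tuple R) :
  measurable_fun [set: measurableTypeR R] (fun a => tcons (a, v)).
Proof. apply: measurable_cons => /=; last exact: measurable_cst.
exact: measurable_id. Qed.

(** Induction on the dimension: Fubini splits off the first coordinate, where
    one-dimensional invariance applies. *)
Lemma ge0_integral_tadd n (b : n.-tuple R) (F : n.-tuple R -> \bar R) :
  measurable_fun setT F -> (forall x, 0 <= F x) ->
  \int[lam]_x F (tadd x b) = \int[lam]_x F x.
Proof.
elim: n b F => [|n IH] b F mF F0.
  by apply: eq_integral => x _; rewrite (tuple0 x) (tuple0 (tadd _ _)).
have [b0 [b' ->]] := tconsP b.
rewrite ge0_integral_tcons//; last first.
  by apply: measurableT_comp => //; apply: measurable_tadd => //; exact: measurable_cst.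
under eq_integral => a _.
  under eq_integral do rewrite tadd_tcons.
  rewrite (IH b' (fun v => F (tcons (a + b0, v)%R)))//; last first.
    by apply: measurableT_comp => //; exact: measurable_tcons_slice.
  over.
rewrite /= (@ge0_integral_shift _ b0 (fun a => \int[lam]_x F (tcons (a, x))))//.
- by rewrite ge0_integral_tcons.
- apply: (measurable_fun_fubini_tonelli_F (F \o @tcons R n)) => //.
  by apply: measurableT_comp => //; exact: measurable_tcons.
  by move=> x; exact: F0.
- by move=> x; exact: integral_ge0.
Qed.

Lemma ge0_integral_topp n (F : n.-tuple R -> \bar R) :
  measurable_fun setT F -> (forall x, 0 <= F x) ->
  \int[lam]_x F (topp x) = \int[lam]_x F x.
Proof.
elim: n F => [|n IH] F mF F0.
  by apply: eq_integral => x _; rewrite (tuple0 x) (tuple0 (topp _)).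
rewrite ge0_integral_tcons//; last first.
  by apply: measurableT_comp => //; exact: measurable_topp.
under eq_integral => a _.
  under eq_integral do rewrite topp_tcons.
  rewrite (IH (fun v => F (tcons (- a, v)%R)))//; last first.
    by apply: measurableT_comp => //; exact: measurable_tcons_slice.
  over.
rewrite /= (@ge0_integral_reflect _ (fun a => \int[lam]_x F (tcons (a, x))))//.
- by rewrite ge0_integral_tcons.
- apply: (measurable_fun_fubini_tonelli_F (F \o @tcons R n)) => //.
  by apply: measurableT_comp => //; exact: measurable_tcons.
  by move=> x; exact: F0.
- by move=> x; exact: integral_ge0.
Qed.

Lemma lebesgue_tuple_hyperplane n (r : R) :
  lam [set x : n.+1.-tuple R | tnth x ord0 = r] = 0.
Proof.
rewrite /= /lebesgue_step /pushforward.
rewrite (_ : _ @^-1` _ = [set r] `*` setT); last first.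
  by apply/seteqP; split => [[a v]|[a v]] /=; rewrite tnth_tcons0 => //= -[].
by rewrite product_measure1E//= lebesgue_measure_set1 mul0e.
Qed.

Lemma ae_tnth_neq n (r : R) :
  {ae @lebesgue_tuple R n.+1, forall x, tnth x ord0 != r}.
Proof.
exists [set x | tnth x ord0 = r]; split.
- rewrite (_ : mkset _ = (fun x => tnth x ord0) @^-1` [set r]) //.
  by rewrite -[X in measurable X]setTI; apply: measurable_tnth.
- exact: lebesgue_tuple_hyperplane.
- by move=> x /= /negP/negPn/eqP.
Qed.

(** For each fixed a, the translation of the last n coordinates by (a/h) z
    leaves the inner integral unchanged; exchanging the order of integration
    afterwards leaves, for each w, an integral along a line directed by
    (h, z). *)
Lemma ge0_integral_shear n (h : R) (z : n.-tuple R)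
    (F : n.+1.-tuple R -> \bar R) :
  measurable_fun setT F -> (forall x, 0 <= F x) ->
  \int[lam]_x F x =
  \int[lam]_w \int[mu]_a F (tcons (a, tadd w (tscale (a / h) z)))%R.
Proof.
move=> mF F0; rewrite ge0_integral_tcons//.
under eq_integral => a _.
  rewrite -(ge0_integral_tadd (tscale (a / h)%R z)
    (F := fun v => F (tcons (a, v))))//; last first.
    by apply: measurableT_comp => //; exact: measurable_tcons_slice.
  over.
rewrite /= (fubini_tonelli
  (fun av : measurableTypeR R * n.-tuple R => F (tcons (av.1, tadd av.2 (tscale (av.1 / h)%R z)))))//.
apply: measurableT_comp => //.
apply: measurable_cons => /=; first exact: measurable_fst.
apply: measurable_tadd; first exact: measurable_snd.
apply: measurable_tscale; last exact: measurable_cst.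
by apply: measurable_funM => //; exact: measurable_cst.
Qed.

End lebesgue_tuple_invariance.

(** * The one-dimensional inequality *)
Section ae_lemmas.
Local Open Scope ereal_scope.

Lemma ae_eq_of_integral_le dd (T : measurableType dd) (R : realType)
    (mu : {measure set T -> \bar R}) (f g : T -> R) :
  measurable_fun setT f -> measurable_fun setT g ->
  (forall x, 0 <= f x)%R -> (forall x, f x <= g x)%R ->
  \int[mu]_x (f x)%:E < +oo ->
  \int[mu]_x (g x)%:E <= \int[mu]_x (f x)%:E ->
  {ae mu, forall x, f x = g x}.
Proof.
move=> mf mg f0 fg foo gf.
have mgf : measurable_fun setT (fun x => (g x - f x)%:E).
  by apply/measurable_EFinP; exact: measurable_funB.
have E : \int[mu]_x (g x)%:E = \int[mu]_x (f x)%:E + \int[mu]_x (g x - f x)%:E.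
  rewrite -ge0_integralD//; last 3 first.
  - by move=> x _; rewrite lee_fin.
  - exact/measurable_EFinP.
  - by move=> x _; rewrite lee_fin subr_ge0.
  by apply: eq_integral => x _; rewrite -EFinD subrKC.
have f1 : \int[mu]_x (f x)%:E \is a fin_num.
  by rewrite ge0_fin_numE// integral_ge0// => x _; rewrite lee_fin.
have : \int[mu]_x (g x - f x)%:E = 0.
  apply/eqP; rewrite eq_le ge0_integral_real ?andbT; last first.
    by move=> x; rewrite subr_ge0.
  by move: gf; rewrite E -{2}(adde0 (\int[mu]_x (f x)%:E)) leeD2lE.
move/(ge0_integral_eq0_ae _ mgf) => H.
have {}/H : forall x, 0 <= (g x - f x)%:E by move=> x; rewrite lee_fin subr_ge0.
by apply: filterS => x [] /eqP; rewrite subr_eq0 => /eqP.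
Qed.

(** Almost-everywhere identities are turned into identities at well-chosen
    points because nonempty open intervals have positive measure. *)
Lemma ae_itv_exists (R : realType) (Q : R -> Prop) (a b : R) :
  (a < b)%R -> {ae (@lebesgue_measure R), forall x, Q x} ->
  exists x, (a < x < b)%R /\ Q x.
Proof.
move=> ab [N [mN N0 QN]]; apply: contrapT => nQ.
have : (lebesgue_measure `]a, b[%classic <= (@lebesgue_measure R) N).
  apply: le_measure; rewrite ?inE// => x /= xab; apply: QN => Qx.
  by apply: nQ; exists x; move: xab; rewrite in_itv.
by rewrite N0 lebesgue_measure_itv/= lte_fin ab -EFinB lee_fin subr_le0 leNgt ab.
Qed.

End ae_lemmas.

Section line.
Context {R : realType}.
Local Notation mu := (@lebesgue_measure R).

(** A nonincreasing gam sees only the larger of |u| and |u + h|, and this is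
    the distance to the midpoint -h/2 plus |h|/2. *)
Lemma min_radial_shift (gam : R -> R) (u h : R) :
  (forall r s, 0 <= r -> r <= s -> gam s <= gam r) ->
  Num.min (gam `|u|) (gam `|u + h|) = gam (`|u + h / 2| + `|h| / 2).
Proof.
move=> dec.
have -> : `|u + h / 2| + `|h| / 2 = Num.max `|u| `|u + h|.
  rewrite /Num.max; case: ifPn; rewrite -?leNgt;
  do 4 (case: ler0P => ? //; rewrite ?normrE); lra.
rewrite /Num.max; case: ifPn => [|/negP/negP]; rewrite -?leNgt => ux.
  by apply/min_idPr/dec => //; exact: ltW.
by apply/min_idPl/dec.
Qed.

Lemma integral_sqr (c : R) : 0 < c ->
  (\int[mu]_(v in `[(- c)%R, c]) (v ^+ 2)%:E = (2 / 3 * c ^+ 3)%:E)%E.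
Proof.
move=> c0.
pose F : R -> R := 3^-1 \*: (fun v => v ^+ 3).
have dF (v : R) : is_derive v 1 F (v ^+ 2).
  apply: is_derive_eq.
  change (3^-1 * (v * (v * 1 + v * 1) + v * v * 1) = v ^+ 2).
  by field.
have cF : continuous F.
  by move=> v; apply: differentiable_continuous; apply/derivable1_diffP; have [] := dF v.
rewrite (@continuous_FTC2 _ (fun v => v ^+ 2) F).
- rewrite -EFinB; congr EFin.
  change (3^-1 * c ^+ 3 - 3^-1 * (- c) ^+ 3 = 2 / 3 * c ^+ 3).
  by field.
- lra.
- apply: continuous_subspaceT => v; exact: exprn_continuous.
- split.
  + by move=> v _; have [] := dF v.
  + by apply: cvg_at_right_filter; exact: cF.
  + by apply: cvg_at_left_filter; exact: cF.
- by move=> v _; rewrite derive1E; have [_ ->] := dF v.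
Qed.

Section one_dimension.
Variable gam : R -> R.
Hypothesis gam0 : forall r, 0 <= r -> 0 <= gam r.
Hypothesis dec : forall r s, 0 <= r -> r <= s -> gam s <= gam r.
Hypothesis mgam : measurable_fun [set: measurableTypeR R] (fun u => gam `|u|).

(** In terms of the kernel k of the introduction, with H = |h|: [far] is the
   region where the shift costs H^2, and 3/4 * H, the radius of [near], is
   where (16/9) v^2 reaches H^2. *)
Let far (H : R) : R -> R := \1_(~` `]- (H / 2), (H / 2)[%classic).
Let near (H : R) : R -> R := \1_(`[- (3 / 4 * H), 3 / 4 * H]%classic).

Let farE H v : far H v = (H / 2 <= `|v|)%R%:R.
Proof.
rewrite /far indicE; congr (1 *+ nat_of_bool _); apply/idP/idP.
  rewrite inE/= in_itv/= => /negP; rewrite -ltr_norml.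
  by rewrite -leNgt.
by move=> Hv; rewrite inE/= in_itv/= -ltr_norml; apply/negP; rewrite -leNgt.
Qed.

Let nearE H v : near H v = (`|v| <= 3 / 4 * H)%R%:R.
Proof.
by rewrite /near indicE mem_setE in_itv/= -ler_norml.
Qed.

Let mfar H : measurable_fun [set: measurableTypeR R] (far H).
Proof. by apply: measurable_indic; apply: measurableC. Qed.

Let mnear H : measurable_fun [set: measurableTypeR R] (near H).
Proof. by apply: measurable_indic. Qed.

(** After the minimum is rewritten as gam(|u + h/2| + |h|/2), the half-lines on
    either side of -h/2 are recentred at 0 and moved outwards by |h|/2: this
    absorbs the added |h|/2 and opens a hole of length |h| around 0. *)
Lemma integral_min_shift_le (h : R) : h != 0 ->
  (\int[mu]_u (Num.min (gam `|u|) (gam `|u + h|))%:E <=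
   \int[mu]_v (far `|h| v * gam `|v|)%:E)%E.
Proof.
move=> h0; have H0 : 0 < `|h| by rewrite normr_gt0.
pose H := `|h|; rewrite -/H in H0 *.
(* The two translated half-lines. Only one of them is closed, hence an
   inequality rather than an equality in the lemma. *)
pose f1 v : \bar R := ((H / 2 <= v)%R%:R * gam `|v|)%:E.
pose f2 v : \bar R := ((v < - (H / 2))%R%:R * gam `|v|)%:E.
have mi (b : interval R) : measurable_fun [set: measurableTypeR R]
   (fun v => (v \in b)%R%:R : R).
  rewrite (_ : (fun _ => _) = \1_([set` b])); first exact: measurable_indic.
  by apply/funext => v; rewrite indicE mem_setE.
have mf1 : measurable_fun [set: measurableTypeR R] f1.
  apply/measurable_EFinP; apply: measurable_funM => //.
  rewrite (_ : (fun _ => _) = (fun v => (v \in `[H / 2, +oo[)%R%:R)) //.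
  by apply/funext => v; rewrite in_itv/= andbT.
have mf2 : measurable_fun [set: measurableTypeR R] f2.
  apply/measurable_EFinP; apply: measurable_funM => //.
  rewrite (_ : (fun _ => _) = (fun v => (v \in `]-oo, - (H / 2)[)%R%:R)) //.
have f10 v : (0 <= f1 v)%E by rewrite lee_fin mulr_ge0// gam0.
have f20 v : (0 <= f2 v)%E by rewrite lee_fin mulr_ge0// gam0.
rewrite (_ : \int[mu]_u _ = \int[mu]_v f1 v + \int[mu]_v f2 v)%E; last first.
  rewrite -(ge0_integral_shift (h / 2 + H / 2) mf1)//.
  rewrite -(ge0_integral_shift (h / 2 - H / 2) mf2)//.
  rewrite -ge0_integralD//; last 2 first.
  - by apply: measurableT_comp mf1 _; exact: measurable_addr.
  - by apply: measurableT_comp mf2 _; exact: measurable_addr.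
  apply: eq_integral => u _; rewrite min_radial_shift// -EFinD; congr EFin.
  rewrite -/H !addrA; case: (ltP (u + h / 2) 0) => u0.
    have -> : (H / 2 <= u + h / 2 + H / 2) = false by apply/negbTE; rewrite -ltNge; lra.
    have -> : (u + h / 2 - H / 2 < - (H / 2)) = true by lra.
    by rewrite mul0r add0r mul1r !ltr0_norm; [congr gam; lra|lra|lra].
  have -> : (H / 2 <= u + h / 2 + H / 2) = true by lra.
  have -> : (u + h / 2 - H / 2 < - (H / 2)) = false by apply/negbTE; rewrite -leNgt; lra.
  by rewrite mul0r addr0 mul1r !ger0_norm; [congr gam; lra|lra|lra].
rewrite -ge0_integralD//; apply: ge0_le_integral => //.
- by move=> v _; rewrite adde_ge0.
- exact: emeasurable_funD.
- by apply/measurable_EFinP; apply: measurable_funM => //; exact: mfar.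
move=> v _; rewrite -EFinD lee_fin -mulrDl ler_wpM2r ?gam0// farE.
have [v1|v1] := ltP v (- (H / 2)).
  have -> : (H / 2 <= v)%R = false by apply/negbTE; rewrite -ltNge; lra.
  have -> : (H / 2 <= `|v|)%R = true by rewrite ltr0_norm; lra.
  by rewrite add0r.
have [v2|v2] := leP (H / 2) v.
  have -> : (H / 2 <= `|v|)%R = true by rewrite ger0_norm; lra.
  by rewrite addr0.
by rewrite addr0 ler0n.
Qed.

Let G (H : R) := gam (H / 2).

(** Both factors of the product in the proof change sign at H/2 and at 3H/4 in
   the same way, k because of its explicit form and gam - G 1_near because gam
   is nonincreasing and nonnegative. The terms carrying G are kept on opposite
   sides so that all four integrals are of nonnegative functions. *)
Let lhs_le_rhs_pointwise H v : 0 < H ->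
  H ^+ 2 * (far H v * gam `|v|) + 16 / 9 * v ^+ 2 * (G H * near H v) <=
  16 / 9 * (v ^+ 2 * gam `|v|) + H ^+ 2 * (G H * (far H v * near H v)).
Proof.
move=> H0.
suff : 0 <= (16 / 9 * v ^+ 2 - H ^+ 2 * far H v) * (gam `|v| - G H * near H v).
  by lra.
rewrite -(real_normK (num_real v)) farE nearE /G.
have v0 : 0 <= `|v| by [].
move: (`|v|) v0 => {}v v0; have g0 := gam0 v0.
have [Hv|vH] := leP (H / 2) v; have [vc|cv] := leP v (3 / 4 * H) => /=.
- rewrite !mulr1; apply: mulr_le0; first by nra.
  by rewrite subr_le0 dec//; lra.
- by rewrite mulr0 subr0 mulr1; apply: mulr_ge0 => //; nra.
- rewrite mulr0 subr0 mulr1; apply: mulr_ge0; first by nra.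
  by rewrite subr_ge0 dec// ltW.
- by lra.
Qed.

(** This integral and the next one agree: the kernel k has zero mean over
   |v| <= 3H/4. *)
Let integral_near H : 0 < H ->
  (\int[mu]_v (16 / 9 * v ^+ 2 * (G H * near H v))%:E =
   (G H * (H ^+ 3 / 2))%:E)%E.
Proof.
move=> H0; have G0 : 0 <= G H by rewrite gam0; lra.
transitivity (\int[mu]_v ((16 / 9 * G H)%:E * (v ^+ 2 * near H v)%:E))%E.
  by apply: eq_integral => v _; rewrite -EFinM; congr EFin; lra.
rewrite ge0_integralZl//; last 3 first.
- by apply/measurable_EFinP; apply: measurable_funM => //; exact: exprn_measurable.
- by move=> v _; rewrite lee_fin nearE mulr_ge0// sqr_ge0.
- by rewrite lee_fin; lra.
transitivity ((16 / 9 * G H)%:E * (2 / 3 * (3 / 4 * H) ^+ 3)%:E)%E; last first.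
  by rewrite -EFinM; congr EFin; field.
congr (_ * _)%E; rewrite -integral_sqr; last by lra.
rewrite [RHS]integral_mkcond; apply: eq_integral => v _.
by rewrite patchE /near indicE; case: ifPn => _; rewrite ?mulr1 ?mulr0.
Qed.

Let integral_far_near H : 0 < H ->
  (\int[mu]_v (H ^+ 2 * (G H * (far H v * near H v)))%:E =
   (G H * (H ^+ 3 / 2))%:E)%E.
Proof.
move=> H0; have G0 : 0 <= G H by rewrite gam0; lra.
pose L := `[- (3 / 4 * H), - (H / 2)]%classic : set (measurableTypeR R).
pose U := `[H / 2, 3 / 4 * H]%classic : set (measurableTypeR R).
have mL : measurable L by exact: measurable_itv.
have mU : measurable U by exact: measurable_itv.
transitivity (\int[mu]_v ((H ^+ 2 * G H)%:E * ((\1_L v)%:E + (\1_U v)%:E)))%E.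
  apply: eq_integral => v _; rewrite -EFinD -EFinM -[in RHS]mulrA; congr (_ * (_ * _))%:E.
  rewrite farE nearE !indicE !mem_setE !in_itv/=.
  case: (ler0P v) => v0.
    rewrite [X in _ + X](_ : _ = 0).
      by rewrite addr0 lerNl [v <= _]lerNr -natrM mulnb andbC.
    by rewrite (_ : (H / 2 <= v) = false)//; apply/negbTE; rewrite -ltNge; lra.
  rewrite [X in X + _](_ : _ = 0); first by rewrite add0r -natrM mulnb.
  rewrite (_ : (v <= - (H / 2)) = false) ?andbF//.
  by apply/negbTE; rewrite -ltNge; lra.
rewrite ge0_integralZl//; last 3 first.
- by apply: emeasurable_funD; apply/measurable_EFinP; exact: measurable_indic.
- by move=> v _; rewrite adde_ge0.
- by rewrite lee_fin mulr_ge0// sqr_ge0.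
rewrite ge0_integralD//; last 2 first.
- by apply/measurable_EFinP; exact: measurable_indic.
- by apply/measurable_EFinP; exact: measurable_indic.
rewrite !integral_indic//= !setIT !lebesgue_measure_itv/= !lte_fin.
rewrite !ifT; [|lra|lra].
by rewrite -!EFinB -EFinD -EFinM; congr EFin; field.
Qed.

Let M2 := (\int[mu]_u (u ^+ 2 * gam `|u|)%:E)%E.
Let L h := (\int[mu]_u (Num.min (gam `|u|) (gam `|u + h|))%:E)%E.

Let lhs H v :=
  H ^+ 2 * (far H v * gam `|v|) + 16 / 9 * v ^+ 2 * (G H * near H v).
Let rhs H v :=
  16 / 9 * (v ^+ 2 * gam `|v|) + H ^+ 2 * (G H * (far H v * near H v)).

Let G_ge0 H : 0 < H -> 0 <= G H.
Proof. by move=> H0; rewrite gam0; lra. Qed.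

Let msqr : measurable_fun [set: measurableTypeR R] (fun v : R => v ^+ 2).
Proof. exact: exprn_measurable. Qed.

Let m1 H : measurable_fun [set: measurableTypeR R]
  (fun v => H ^+ 2 * (far H v * gam `|v|)).
Proof. by do 2 (apply: measurable_funM => //). Qed.

Let m2 H : measurable_fun [set: measurableTypeR R]
  (fun v => 16 / 9 * v ^+ 2 * (G H * near H v)).
Proof. by do 2 (apply: measurable_funM => //); exact: measurable_funM. Qed.

Let m3 : measurable_fun [set: measurableTypeR R]
  (fun v => 16 / 9 * (v ^+ 2 * gam `|v|)).
Proof. by do 2 (apply: measurable_funM => //). Qed.

Let m4 H : measurable_fun [set: measurableTypeR R]
  (fun v => H ^+ 2 * (G H * (far H v * near H v))).
Proof. by do 3 (apply: measurable_funM => //). Qed.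

Let p1 H v : 0 <= H ^+ 2 * (far H v * gam `|v|).
Proof.
by rewrite farE mulr_ge0 ?sqr_ge0// mulr_ge0 ?gam0.
Qed.

Let p2 H v : 0 < H -> 0 <= 16 / 9 * v ^+ 2 * (G H * near H v).
Proof.
move=> H0; rewrite nearE mulr_ge0//; first by rewrite mulr_ge0 ?sqr_ge0.
by rewrite mulr_ge0 ?G_ge0.
Qed.

Let p3 v : 0 <= 16 / 9 * (v ^+ 2 * gam `|v|).
Proof.
by rewrite mulr_ge0// mulr_ge0 ?sqr_ge0 ?gam0.
Qed.

Let p4 H v : 0 < H -> 0 <= H ^+ 2 * (G H * (far H v * near H v)).
Proof.
move=> H0; rewrite farE nearE mulr_ge0 ?sqr_ge0//.
by rewrite mulr_ge0 ?G_ge0// mulr_ge0.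
Qed.

Let integral_lhs H : 0 < H -> (\int[mu]_v (lhs H v)%:E =
  (H ^+ 2)%:E * \int[mu]_v (far H v * gam `|v|)%:E + (G H * (H ^+ 3 / 2))%:E)%E.
Proof.
move=> H0; rewrite -integral_near// -ge0_integralZl//; last 3 first.
- by apply/measurable_EFinP; exact: measurable_funM.
- by move=> v _; rewrite lee_fin farE mulr_ge0 ?gam0.
- by rewrite lee_fin sqr_ge0.
rewrite -ge0_integralD//.
- by move=> v _; rewrite -EFinM lee_fin p1.
- by under eq_fun do rewrite -EFinM; apply/measurable_EFinP; exact: m1.
- by move=> v _; rewrite lee_fin p2.
- apply/measurable_EFinP; exact: m2.
Qed.

Let integral_rhs H : 0 < H -> (\int[mu]_v (rhs H v)%:E =
  (16 / 9)%:E * M2 + (G H * (H ^+ 3 / 2))%:E)%E.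
Proof.
move=> H0; rewrite -integral_far_near// -ge0_integralZl//; last 2 first.
- by apply/measurable_EFinP; exact: measurable_funM.
- by move=> v _; rewrite lee_fin mulr_ge0 ?gam0 ?sqr_ge0.
rewrite -ge0_integralD//.
- by move=> v _; rewrite -EFinM lee_fin p3.
- by under eq_fun do rewrite -EFinM; apply/measurable_EFinP; exact: m3.
- by move=> v _; rewrite lee_fin p4.
- apply/measurable_EFinP; exact: m4.
Qed.

Let lhs_ge0 H v : 0 < H -> 0 <= lhs H v.
Proof. by move=> H0; rewrite addr_ge0 ?p1 ?p2. Qed.

Let mlhs H : measurable_fun [set: measurableTypeR R] (lhs H).
Proof. exact: measurable_funD. Qed.

Let mrhs H : measurable_fun [set: measurableTypeR R] (rhs H).
Proof. exact: measurable_funD. Qed.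

Let le_far h : h != 0 ->
  ((h ^+ 2)%:E * L h <=
   (`|h| ^+ 2)%:E * \int[mu]_v (far `|h| v * gam `|v|)%:E)%E.
Proof.
move=> h0; rewrite real_normK ?num_real// lee_wpmul2l ?lee_fin ?sqr_ge0//.
exact: integral_min_shift_le.
Qed.

Lemma shifted_overlap_le (h : R) : h != 0 ->
  ((h ^+ 2)%:E * \int[mu]_u (Num.min (gam `|u|) (gam `|u + h|))%:E <=
   (16 / 9)%:E * \int[mu]_u (u ^+ 2 * gam `|u|)%:E)%E.
Proof.
move=> h0; apply: le_trans (le_far h0) _.
have H0 : 0 < `|h| by rewrite normr_gt0.
suff : (\int[mu]_v (lhs `|h| v)%:E <= \int[mu]_v (rhs `|h| v)%:E)%E.
  by rewrite integral_lhs// integral_rhs// leeD2rE.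
apply: ge0_le_integral => //.
- by move=> v _; rewrite lee_fin lhs_ge0.
- exact/measurable_EFinP.
- exact/measurable_EFinP.
- by move=> v _; rewrite lee_fin lhs_le_rhs_pointwise.
Qed.

(** Equality of finite integrals of pointwise ordered functions forces the
   functions to agree almost everywhere. *)
Let extremal_shift_ae (h : R) : h != 0 -> (M2 < +oo)%E ->
  ((16 / 9)%:E * M2 <= (h ^+ 2)%:E * L h)%E ->
  {ae mu, forall v, lhs `|h| v = rhs `|h| v}.
Proof.
move=> h0 Moo Mle; have H0 : 0 < `|h| by rewrite normr_gt0.
have M20 : (0 <= M2)%E.
  by apply: integral_ge0 => v _; rewrite lee_fin mulr_ge0 ?gam0 ?sqr_ge0.
have le : (\int[mu]_v (lhs `|h| v)%:E <= \int[mu]_v (rhs `|h| v)%:E)%E.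
  apply: ge0_le_integral => //.
  - by move=> v _; rewrite lee_fin lhs_ge0.
  - exact/measurable_EFinP.
  - exact/measurable_EFinP.
  - by move=> v _; rewrite lee_fin lhs_le_rhs_pointwise.
apply: ae_eq_of_integral_le => //.
- by move=> v; exact: lhs_ge0.
- by move=> v; exact: lhs_le_rhs_pointwise.
- apply: le_lt_trans le _; rewrite integral_rhs//.
  by rewrite lte_add_pinfty ?ltry// lte_mul_pinfty ?lee_fin.
- rewrite integral_lhs// integral_rhs// leeD2rE//.
  exact: le_trans Mle (le_far h0).
Qed.

Let eq_factor H v : lhs H v = rhs H v ->
  (16 / 9 * v ^+ 2 - H ^+ 2 * far H v) * (gam `|v| - G H * near H v) = 0.
Proof. rewrite /lhs /rhs => e; lra. Qed.

(** If both shifts were extremal, the smaller one would make gam vanish beyond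
    3|h|/4, hence at some points below 3|k|/4; but for the larger one gam must
    be equal to gam(|k|/2) almost everywhere between |k|/2 and 3|k|/4. So
    gam(|k|/2) = 0, and then the equality case for k, with a kernel that is
    positive on (0, |k|/2), makes gam vanish there too, against 0 < M2. *)
Lemma no_two_extremal_shifts (h k : R) : 0 < `|h| -> `|h| < `|k| ->
  (0 < M2)%E -> (M2 < +oo)%E ->
  ((16 / 9)%:E * M2 <= (h ^+ 2)%:E * L h)%E ->
  ((16 / 9)%:E * M2 <= (k ^+ 2)%:E * L k)%E -> False.
Proof.
move=> H0 HK Mgt0 Moo Mh Mk; have K0 : 0 < `|k| by exact: lt_trans HK.
have h0 : h != 0 by rewrite -normr_gt0.
have k0 : k != 0 by rewrite -normr_gt0.
have aeh := extremal_shift_ae h0 Moo Mh; have aek := extremal_shift_ae k0 Moo Mk.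
move: (`|h|) (`|k|) H0 HK K0 aeh aek => H K H0 HK K0 aeh aek {h k Mh Mk h0 k0}.
have [v [/andP[v1 v2] /eq_factor]] : exists v, 3 / 4 * H < v < 3 / 4 * K /\
    lhs H v = rhs H v by apply: ae_itv_exists => //; lra.
have v0 : 0 <= v by lra.
rewrite farE nearE ger0_norm// (lt_geF v1) mulr0 subr0 => /eqP.
rewrite mulf_eq0 => /orP[|/eqP gv].
  have -> : (H / 2 <= v) = true by lra.
  have : 0 < 16 / 9 * v ^+ 2 - H ^+ 2 * 1 by nra.
  by rewrite lt_neqAle eq_sym => /andP[/negbTE ->].
(* v lies beyond the critical radius of H, where equality needs gam v = 0. *)
have gz w : v <= w -> gam w = 0.
  move=> vw; apply/eqP; rewrite eq_le gam0 ?andbT; last by lra.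
  by rewrite -gv dec.
(* w lies where the kernel of K is negative and gam w = 0 already. *)
have [w [/andP[w1 w2] /eq_factor]] : exists w, Num.max v (K / 2) < w < 3 / 4 * K /\
    lhs K w = rhs K w.
  by apply: ae_itv_exists => //; rewrite gt_max v2/=; lra.
move: w1; rewrite gt_max => /andP[w1 w3].
have w0 : 0 <= w by lra.
rewrite farE nearE !(ger0_norm w0) (gz _ (ltW w1)).
rewrite (ltW w2) (ltW w3) !mulr1 sub0r mulrN => /eqP; rewrite oppr_eq0 mulf_eq0.
move=> /orP[|/eqP GK].
  have : 16 / 9 * w ^+ 2 - K ^+ 2 < 0 by nra.
  by rewrite lt_neqAle => /andP[/negbTE ->].
have gz' u : 0 < u -> gam u = 0.
  move=> u0; have [uK|Ku] := ltP u (K / 2); last first.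
    apply/eqP; rewrite eq_le gam0 ?andbT; last by lra.
    by rewrite -GK /G dec//; lra.
  have [x [/andP[x1 x2] /eq_factor]] : exists x, 0 < x < u /\ lhs K x = rhs K x.
    exact: ae_itv_exists.
  rewrite farE nearE ger0_norm; last by lra.
  rewrite GK mul0r subr0 (lt_geF (lt_trans x2 uK)) mulr0 subr0.
  move=> /eqP; rewrite mulf_eq0 => /orP[|/eqP gx].
    have : 0 < 16 / 9 * x ^+ 2 by nra.
    by rewrite lt_neqAle eq_sym => /andP[/negbTE ->].
  by apply/eqP; rewrite eq_le gam0 ?andbT -?gx ?dec//; lra.
move: Mgt0; rewrite /M2 integral0_eq ?ltxx// => u _.
have [->|u0] := eqVneq u 0; first by rewrite expr0n mul0r.
by rewrite gz' ?mulr0// normr_gt0.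
Qed.

End one_dimension.

End line.

(** * Slicing by lines parallel to the shift *)
Section algebra.
Context {R : realType} {n : nat}.

Definition tdot (x y : n.-tuple R) : R := \sum_(i < n) tnth x i * tnth y i.

Lemma sqnorm_ge0 (x : n.-tuple R) : 0 <= sqnorm x.
Proof. by apply: sumr_ge0 => i _; exact: sqr_ge0. Qed.

Lemma sqnorm_eq0 (x : n.-tuple R) : sqnorm x = 0 -> forall i, tnth x i = 0.
Proof.
move=> /eqP; rewrite psumr_eq0 => [/allP x0 i|i _]; last exact: sqr_ge0.
by have := x0 i (mem_index_enum i); rewrite sqrf_eq0 => /eqP.
Qed.

Lemma sqnorm_tadd_tscale (w z : n.-tuple R) (t : R) :
  sqnorm (tadd w (tscale t z)) =
  sqnorm w + 2 * t * tdot w z + t ^+ 2 * sqnorm z.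
Proof.
rewrite /sqnorm /tdot !mulr_sumr -!big_split/=; apply: eq_bigr => i _.
by rewrite !tnth_mktuple; ring.
Qed.

Lemma enormE (x : n.-tuple R) : enorm x = Num.sqrt (sqnorm x).
Proof. by []. Qed.

Lemma enorm_sqr (x : n.-tuple R) : enorm x ^+ 2 = sqnorm x.
Proof. by rewrite sqr_sqrtr// sqnorm_ge0. Qed.

End algebra.

Lemma sqnorm_tcons {R : realType} n (a : R) (v : n.-tuple R) :
  sqnorm (tcons (a, v)) = a ^+ 2 + sqnorm v.
Proof.
rewrite /sqnorm big_ord_recl tnth_tcons0; congr (_ + _).
by apply: eq_bigr => i _; rewrite tnth_tconsS.
Qed.

Section lines.
Context {R : realType} {n : nat}.
Variables (h : R) (z : n.-tuple R).
Hypothesis h0 : h != 0.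

Definition line (w : n.-tuple R) (a : R) : n.+1.-tuple R :=
  tcons (a, tadd w (tscale (a / h) z)).

(** The parameter of the point of [line w] nearest to the origin. *)
Definition line_foot (w : n.-tuple R) : R :=
  - (tdot w z * h / sqnorm (tcons (h, z))).

Lemma line_tadd w a : tadd (line w a) (tcons (h, z)) = line w (a + h).
Proof.
rewrite /line tadd_tcons; congr (tcons (_, _)).
apply: eq_from_tnth => i; rewrite !tnth_mktuple.
by rewrite -addrA mulrDl divff// mulrDl mul1r.
Qed.

Lemma sqnorm_dir_gt0 : 0 < sqnorm (tcons (h, z)).
Proof. by rewrite sqnorm_tcons ltr_pwDl ?sqnorm_ge0// exprn_even_gt0. Qed.

(** Pythagoras: the squared norm splits into the distance along the line from
    its foot and the distance from the foot to the origin. The factor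
    |(h, z)|^2 / h^2 converts the parameter, which is the first coordinate,
    into arc length. *)
Lemma sqnorm_line w u : sqnorm (line w (u + line_foot w)) =
  sqnorm (tcons (h, z)) / h ^+ 2 * u ^+ 2 + sqnorm (line w (line_foot w)).
Proof.
have N0 : h ^+ 2 + sqnorm z != 0 by rewrite -sqnorm_tcons gt_eqF ?sqnorm_dir_gt0.
rewrite /line !sqnorm_tcons !sqnorm_tadd_tscale /line_foot sqnorm_tcons.
by field; rewrite h0 N0.
Qed.

Lemma measurable_line :
  measurable_fun setT (fun wa : n.-tuple R * measurableTypeR R =>
    line wa.1 wa.2).
Proof.
apply: measurable_cons => /=; first exact: measurable_snd.
apply: measurable_tadd; first exact: measurable_fst.
apply: measurable_tscale; last exact: measurable_cst.
by apply: measurable_funM => //; exact: measurable_cst.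
Qed.

Lemma measurable_line1 w :
  measurable_fun [set: measurableTypeR R] (line w).
Proof.
apply: measurable_cons => /=; first exact: measurable_id.
apply: measurable_tadd; first exact: measurable_cst.
apply: measurable_tscale; last exact: measurable_cst.
by apply: measurable_funM => //; exact: measurable_cst.
Qed.

End lines.

Section moments.
Context {R : realType} {d : nat} (pi : d.-tuple R -> R).
Local Notation lam := (@lebesgue_tuple R d).
Local Open Scope ereal_scope.

Definition second_moment := \int[lam]_x (sqnorm x * pi x)%:E.

(** For the chain with proposal density phi, phi(z) times this is the density
    of the contribution of the displacement z to E|X_1 - X_0|^2. *)
Definition overlap (z : d.-tuple R) :=
  (sqnorm z)%:E * \int[lam]_x (Num.min (pi x) (pi (tadd x z)))%:E.

End moments.

Section radial.
Context {R : realType} {n : nat}.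
Variables (pi : n.+1.-tuple R -> R) (pihat : R -> R).
Hypothesis mpi : measurable_fun setT pi.
Hypothesis pi0 : forall x, 0 <= pi x.
Hypothesis dec : forall r s, 0 <= r -> r <= s -> pihat s <= pihat r.
Hypothesis piE : forall x, pi x = pihat (enorm x).
Local Notation mu := (@lebesgue_measure R).
Local Notation lam := (@lebesgue_tuple R _).
Local Open Scope ereal_scope.

(** The one-dimensional inequality on a single line. Its deficit contains the
    squared distance of the line to the origin, which is kept for the sake of
    strictness. *)
Lemma overlap_line_le (h : R) (z w : n.-tuple R) : h != 0%R ->
  (sqnorm (tcons (h, z)))%:E *
    \int[mu]_a (Num.min (pi (line h z w a)) (pi (line h z w (a + h))))%:E +
  (16 / 9)%:E * ((sqnorm (line h z w (line_foot h z w)))%:E *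
    \int[mu]_a (pi (line h z w a))%:E) <=
  (16 / 9)%:E * \int[mu]_a (sqnorm (line h z w a) * pi (line h z w a))%:E.
Proof.
move=> h0; set N := sqnorm (tcons (h, z)); set c := line_foot h z w.
set D := sqnorm (line h z w c).
have N0 : (0 < N)%R by exact: sqnorm_dir_gt0.
have h20 : (0 < h ^+ 2)%R by rewrite exprn_even_gt0.
pose q := (N / h ^+ 2)%R; have q0 : (0 < q)%R by rewrite divr_gt0.
have D0 : (0 <= D)%R by exact: sqnorm_ge0.
(* The profile of pi along the line, seen from the foot c. *)
pose gam r := pihat (Num.sqrt (q * r ^+ 2 + D)).
have gamE u : pi (line h z w (u + c)) = gam `|u|%R.
  by rewrite piE enormE sqnorm_line// /gam real_normK// num_real.
have gam0 r : (0 <= r)%R -> (0 <= gam r)%R.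
  by move=> r0; rewrite -(ger0_norm r0) -gamE.
have gamdec r s : (0 <= r)%R -> (r <= s)%R -> (gam s <= gam r)%R.
  move=> r0 rs; apply: dec; first exact: sqrtr_ge0.
  rewrite ler_sqrt; last by rewrite addr_ge0// mulr_ge0 ?sqr_ge0// ltW.
  by rewrite lerD2r ler_pM2l// ler_sqr ?nnegrE//; exact: le_trans rs.
have ml a : measurable_fun [set: measurableTypeR R] (fun u => pi (line h z w (u + a)%R)).
  apply: measurableT_comp => //.
  by apply: (measurableT_comp (measurable_line1 h z w)); exact: measurable_addr.
have ml0 : measurable_fun [set: measurableTypeR R] (fun u => pi (line h z w u)).
  apply: measurableT_comp => //; exact: measurable_line1.
have ms0 : measurable_fun [set: measurableTypeR R] (fun u => sqnorm (line h z w u)).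
  by apply: measurable_sqnorm; exact: measurable_line1.
have mgam : measurable_fun [set: measurableTypeR R] (fun u => gam `|u|%R).
  by under eq_fun do rewrite -gamE; exact: ml.
rewrite -(@ge0_integral_shift _ c
    (fun a => (Num.min (pi (line h z w a)) (pi (line h z w (a + h))))%:E))//; last 2 first.
- by apply/measurable_EFinP; exact: measurable_minr.
- by move=> x; rewrite lee_fin le_min !pi0.
rewrite -(@ge0_integral_shift _ c (fun a => (pi (line h z w a))%:E))//; last 2 first.
- exact/measurable_EFinP.
- by move=> x; rewrite lee_fin.
rewrite -(@ge0_integral_shift _ c
    (fun a => (sqnorm (line h z w a) * pi (line h z w a))%:E))//; last 2 first.
- by apply/measurable_EFinP; exact: measurable_funM.
- by move=> x; rewrite lee_fin mulr_ge0// sqnorm_ge0.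
under [X in _ * X + _]eq_integral do rewrite addrAC !gamE.
under [X in _ + _ * (_ * X)]eq_integral do rewrite gamE.
under [X in _ <= _ * X]eq_integral do rewrite gamE sqnorm_line// -/N -/c -/D -/q.
have gabs0 (u : R) : (0 <= gam `|u|)%R by rewrite gam0.
have mu2 : measurable_fun [set: measurableTypeR R] (fun u => u ^+ 2 * gam `|u|)%R.
  by apply: measurable_funM => //; exact: exprn_measurable.
have u20 (u : R) : (0 <= u ^+ 2 * gam `|u|)%R by rewrite mulr_ge0 ?sqr_ge0.
have -> : \int[mu]_u ((q * u ^+ 2 + D) * gam `|u|)%:E =
    q%:E * \int[mu]_u (u ^+ 2 * gam `|u|)%:E + D%:E * \int[mu]_u (gam `|u|)%:E.
  rewrite -(ge0_integralZl_real mu mu2 u20 (ltW q0)).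
  rewrite -(ge0_integralZl_real mu mgam gabs0 D0).
  rewrite -ge0_integralD_real//.
  - by apply: eq_integral => u _; congr EFin; ring.
  - exact: measurable_funM.
  - by move=> u; rewrite mulr_ge0// ltW.
  - exact: measurable_funM.
  - by move=> u; rewrite mulr_ge0.
rewrite [leRHS]ge0_muleDr ?mule_ge0 ?lee_fin ?(ltW q0) ?ge0_integral_real//.
rewrite leeD2r// (_ : N = q * h ^+ 2)%R; last by rewrite /q divfK ?gt_eqF.
rewrite EFinM -muleA [leRHS]muleCA lee_wpmul2l ?lee_fin ?(ltW q0)//.
exact: shifted_overlap_le.
Qed.

Section overlap_sum.
Variables (h : R) (z : n.-tuple R).
Hypothesis h0 : h != 0%R.
Let Z := tcons (h, z).

Definition line_dist2 (w : n.-tuple R) := sqnorm (line h z w (line_foot h z w)).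

Let mline (F : n.+1.-tuple R -> R) : measurable_fun setT F ->
  measurable_fun setT (fun wa : n.-tuple R * measurableTypeR R =>
    (F (line h z wa.1 wa.2))%:E).
Proof.
move=> mF; apply/measurable_EFinP; apply: measurableT_comp => //.
exact: measurable_line.
Qed.

Lemma measurable_line_integral (F : n.+1.-tuple R -> R) : measurable_fun setT F ->
  (forall x, 0 <= F x)%R ->
  measurable_fun setT (fun w : n.-tuple R => \int[mu]_a (F (line h z w a))%:E).
Proof.
move=> mF F0; apply: (measurable_fun_fubini_tonelli_F (m2 := mu)
  (fun wa : n.-tuple R * measurableTypeR R => (F (line h z wa.1 wa.2))%:E)).
  exact: mline.
by move=> x; rewrite lee_fin.
Qed.

Lemma measurable_line_dist2 : measurable_fun setT line_dist2.
Proof.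
have mfoot : measurable_fun setT (line_foot h z).
  apply: measurable_funN; apply: measurable_funM; last exact: measurable_cst.
  apply: measurable_funM; last exact: measurable_cst.
  apply: measurable_sum => i; apply: measurable_funM; last exact: measurable_cst.
  exact: measurable_tnth.
apply: measurable_sqnorm; apply: measurable_cons => //=.
apply: measurable_tadd; first exact: measurable_id.
apply: measurable_tscale; last exact: measurable_cst.
by apply: measurable_funM => //; exact: measurable_cst.
Qed.

Lemma integral_line (F : n.+1.-tuple R -> R) : measurable_fun setT F ->
  (forall x, 0 <= F x)%R ->
  \int[lam]_x (F x)%:E = \int[lam]_w \int[mu]_a (F (line h z w a))%:E.
Proof.
move=> mF F0; rewrite (ge0_integral_shear h z)//.
exact/measurable_EFinP.
Qed.

Let F1 x := Num.min (pi x) (pi (tadd x Z)).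
Let mF1 : measurable_fun setT F1.
Proof.
apply: measurable_minr => //; apply: measurableT_comp => //.
by apply: measurable_tadd => //; exact: measurable_cst.
Qed.
Let F10 x : (0 <= F1 x)%R. Proof. by rewrite le_min !pi0. Qed.

Let F2 x := (sqnorm x * pi x)%R.
Let mF2 : measurable_fun setT F2.
Proof. by apply: measurable_funM => //; exact: measurable_sqnorm. Qed.
Let F20 x : (0 <= F2 x)%R. Proof. by rewrite mulr_ge0 ?sqnorm_ge0. Qed.

Lemma overlap_le_dist2 :
  overlap pi Z + (16 / 9)%:E * \int[lam]_w
    ((sqnorm (line h z w (line_foot h z w)))%:E *
     \int[mu]_a (pi (line h z w a))%:E) <= (16 / 9)%:E * second_moment pi.
Proof.
rewrite /overlap /second_moment (integral_line mF1 F10) (integral_line mF2 F20).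
have mg : measurable_fun setT (fun w => (line_dist2 w)%:E *
    \int[mu]_a (pi (line h z w a))%:E).
  by apply: emeasurable_funM; [apply/measurable_EFinP; exact: measurable_line_dist2|exact: measurable_line_integral].
have g0 w : 0 <= (line_dist2 w)%:E * \int[mu]_a (pi (line h z w a))%:E.
  by rewrite mule_ge0 ?lee_fin ?sqnorm_ge0// ge0_integral_real.
have m1 := measurable_line_integral mF1 F10; have m2 := measurable_line_integral mF2 F20.
have scale k (G : n.-tuple R -> \bar R) : measurable_fun setT G ->
    (forall w, 0 <= G w) -> (0 <= k)%R ->
    k%:E * \int[lam]_w G w = \int[lam]_w (k%:E * G w).
  by move=> mG G0 k0; rewrite ge0_integralZl.
rewrite !scale//; last 3 first.
- by move=> w; exact: ge0_integral_real.
- by move=> w; exact: ge0_integral_real.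
- exact: sqnorm_ge0.
rewrite -ge0_integralD//; last 4 first.
- by move=> w _; rewrite mule_ge0 ?lee_fin ?sqnorm_ge0// ge0_integral_real.
- by apply: emeasurable_funM => //; exact: measurable_cst.
- by move=> w _; rewrite mule_ge0 ?lee_fin//; exact: g0.
- by apply: emeasurable_funM => //; exact: measurable_cst.
apply: ge0_le_integral => //.
- move=> w _; rewrite adde_ge0// mule_ge0 ?lee_fin ?sqnorm_ge0//; last exact: g0.
  exact: ge0_integral_real.
- apply: emeasurable_funD; apply: emeasurable_funM => //; exact: measurable_cst.
- by apply: emeasurable_funM => //; exact: measurable_cst.
move=> w _; have := overlap_line_le z w h0.
rewrite /F1; under [X in _ <= _ -> _ * X + _ <= _]eq_integral do rewrite line_tadd//.
by [].
Qed.

End overlap_sum.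

Hypothesis pi_neq0 : \int[lam]_x (pi x)%:E <> 0.

Lemma overlap_le (h : R) (z : n.-tuple R) : h != 0%R ->
  overlap pi (tcons (h, z)) <= (16 / 9)%:E * second_moment pi.
Proof.
move=> h0; apply: le_trans (overlap_le_dist2 z h0); rewrite leeDl// mule_ge0//.
apply: integral_ge0 => w _; rewrite mule_ge0 ?lee_fin ?sqnorm_ge0//.
exact: ge0_integral_real.
Qed.

(** The integrand vanishes off the origin only where pi does, and the origin is
    contained in a null hyperplane. *)
Lemma second_moment_gt0 : 0 < second_moment pi.
Proof.
have m2 : measurable_fun setT (fun x => (sqnorm x * pi x)%:E).
  by apply/measurable_EFinP; apply: measurable_funM => //; exact: measurable_sqnorm.
have p2 x : (0 <= sqnorm x * pi x)%R by rewrite mulr_ge0 ?sqnorm_ge0.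
rewrite lt0e ge0_integral_real// andbT; apply/eqP.
move/(ge0_integral_eq0_ae _ m2) => H; apply: pi_neq0.
have {}H := H (fun x => p2 x).
apply/(ge0_integral_eq0_ae _ _ _).2.
- exact/measurable_EFinP.
- by move=> x; rewrite lee_fin.
apply: filterS2 (ae_tnth_neq n 0%R) H => x x0 [] /eqP; rewrite mulf_eq0 => /orP[|/eqP ->//].
by move=> /eqP/sqnorm_eq0/(_ ord0)/eqP; rewrite (negbTE x0).
Qed.

(** If equality held, the deficit would vanish: the integral of pi along almost
    every line not through the origin would be zero, and so would the integral
    of pi. The first hypothesis, that the origin of the transversal is
    negligible, is what fails in dimension one. *)
Lemma overlap_lt (h : R) (z : n.-tuple R) :
  {ae @lebesgue_tuple R n, forall w, sqnorm w != 0%R} ->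
  second_moment pi < +oo -> h != 0%R ->
  overlap pi (tcons (h, z)) < (16 / 9)%:E * second_moment pi.
Proof.
move=> w0 Moo h0; rewrite lt_neqAle overlap_le// andbT; apply/eqP => E.
have := overlap_le_dist2 z h0; rewrite E.
have fin : (16 / 9)%:E * second_moment pi \is a fin_num.
  by rewrite fin_numM// ge0_fin_numE// ltW// second_moment_gt0.
set I := integral _ _ _.
have I0 : 0 <= I.
  apply: integral_ge0 => w _; rewrite mule_ge0 ?lee_fin ?sqnorm_ge0//.
  exact: ge0_integral_real.
rewrite -[leRHS]adde0 leeD2lE// => I1.
have {I1} : I = 0.
  apply/eqP; rewrite eq_le I0 andbT; move: I1.
  by rewrite pmule_rle0.
rewrite /I => /(ge0_integral_eq0_ae _ _ _).1 H.
apply: pi_neq0; rewrite (integral_line h z)//.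
apply/(ge0_integral_eq0_ae _ _ _).2.
- exact: measurable_line_integral.
- by move=> w; exact: ge0_integral_real.
apply: filterS2 w0 (H _ _).
- move=> w w0 /eqP; rewrite mule_eq0 => /orP[|/eqP//].
  rewrite eqe sqnorm_tcons paddr_eq0 ?sqr_ge0 ?sqnorm_ge0// sqrf_eq0.
  move=> /andP[/eqP ->]; rewrite mul0r sqnorm_tadd_tscale.
  by rewrite expr0n/= !mulr0 !mul0r !addr0 (negbTE w0).
- apply: emeasurable_funM; last exact: measurable_line_integral.
  apply/measurable_EFinP; exact: measurable_line_dist2.
- move=> w; rewrite mule_ge0 ?lee_fin ?sqnorm_ge0//.
  exact: ge0_integral_real.
Qed.

End radial.

(** * Almost every shift is strictly suboptimal *)
Section dimension_one.
Context {R : realType}.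
Variables (pi : 1.-tuple R -> R) (pihat : R -> R).
Hypothesis mpi : measurable_fun setT pi.
Hypothesis pi0 : forall x, 0 <= pi x.
Hypothesis dec : forall r s, 0 <= r -> r <= s -> pihat s <= pihat r.
Hypothesis piE : forall x, pi x = pihat (enorm x).
Hypothesis pi_neq0 : (\int[lebesgue_tuple 1]_x (pi x)%:E <> 0)%E.
Local Notation mu := (@lebesgue_measure R).
Local Notation emb a := (tcons (a, [tuple] : 0.-tuple R)).
Local Open Scope ereal_scope.

Lemma integral_tuple1 (F : 1.-tuple R -> R) : measurable_fun setT F ->
  (forall x, 0 <= F x)%R ->
  \int[lebesgue_tuple 1]_x (F x)%:E = \int[mu]_a (F (emb a))%:E.
Proof.
move=> mF F0; rewrite ge0_integral_tcons; last 2 first.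
- exact/measurable_EFinP.
- by move=> x; rewrite lee_fin.
apply: eq_integral => a _; rewrite integral_dirac ?diracT ?mul1e//.
apply/measurable_EFinP; apply: measurableT_comp => //.
exact: measurable_tcons_slice.
Qed.

Lemma sqnorm_emb a : sqnorm (emb a) = (a ^+ 2)%R.
Proof. by rewrite sqnorm_tcons /sqnorm big_ord0 addr0. Qed.

Lemma pi_emb a : pi (emb a) = pihat `|a|%R.
Proof. by rewrite piE enormE sqnorm_emb sqrtr_sqr. Qed.

Lemma overlap_attained_norm_unique (h k : R) (z w : 0.-tuple R) :
  second_moment pi < +oo -> h != 0%R -> k != 0%R ->
  (16 / 9)%:E * second_moment pi <= overlap pi (tcons (h, z)) ->
  (16 / 9)%:E * second_moment pi <= overlap pi (tcons (k, w)) ->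
  `|h|%R = `|k|%R.
Proof.
have pihat0 r : (0 <= r)%R -> (0 <= pihat r)%R.
  by move=> r0; rewrite -(ger0_norm r0) -pi_emb.
have mgam : measurable_fun [set: measurableTypeR R] (fun u => pihat `|u|%R).
  under eq_fun do rewrite -pi_emb; apply: measurableT_comp => //.
  exact: measurable_tcons_line.
have M2 : second_moment pi = \int[mu]_u (u ^+ 2 * pihat `|u|)%:E.
  rewrite /second_moment integral_tuple1.
  - by apply: eq_integral => u _; rewrite sqnorm_emb pi_emb.
  - by apply: measurable_funM => //; exact: measurable_sqnorm.
  - by move=> x; rewrite mulr_ge0 ?sqnorm_ge0.
have ov a (v : 0.-tuple R) : overlap pi (tcons (a, v)) = (a ^+ 2)%:E *
    \int[mu]_u (Num.min (pihat `|u|) (pihat `|u + a|))%:E.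
  rewrite (tuple0 v) /overlap sqnorm_emb integral_tuple1.
  - congr (_ * _); apply: eq_integral => u _.
    by rewrite tadd_tcons (tuple0 (tadd _ _)) !pi_emb.
  - apply: measurable_minr => //; apply: measurableT_comp => //.
    by apply: measurable_tadd => //; exact: measurable_cst.
  - by move=> x; rewrite le_min !pi0.
have M0 := second_moment_gt0 mpi pi0 pi_neq0.
rewrite !ov M2 in M0 * => Moo h0 k0 Mh Mk.
have [hk|kh|//] := ltgtP `|h|%R `|k|%R.
- by have := no_two_extremal_shifts pihat0 dec mgam _ hk M0 Moo Mh Mk; rewrite normr_gt0 => /(_ h0).
- by have := no_two_extremal_shifts pihat0 dec mgam _ kh M0 Moo Mk Mh; rewrite normr_gt0 => /(_ k0).
Qed.

End dimension_one.

(** In dimension at least two the exceptional shifts lie in the hyperplane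
    where the first coordinate vanishes. In dimension one they lie in
    {0, k, -k} for any extremal k. *)
Lemma overlap_lt_ae (R : realType) n (pi : n.+1.-tuple R -> R) (pihat : R -> R) :
  measurable_fun setT pi -> (forall x, 0 <= pi x) ->
  (forall r s, 0 <= r -> r <= s -> pihat s <= pihat r) ->
  (forall x, pi x = pihat (enorm x)) ->
  (\int[lebesgue_tuple n.+1]_x (pi x)%:E <> 0)%E ->
  (second_moment pi < +oo)%E ->
  {ae lebesgue_tuple n.+1, forall z,
    (overlap pi z < (16 / 9)%:E * second_moment pi)%E}.
Proof.
case: n pi => [|n] pi mpi pi0 dec piE pin0 Moo; last first.
  apply: filterS (ae_tnth_neq n.+1 0) => x.
  have [h [z ->]] := tconsP x; rewrite tnth_tcons0 => h0.
  apply: (@overlap_lt _ _ pi pihat) => //.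
  apply: filterS (ae_tnth_neq n 0) => w; apply: contra => /eqP.
  by move=> /sqnorm_eq0 ->.
have [[k [w [k0 Mk]]]|nex] := pselect (exists k w, k != 0 /\
    ((16 / 9)%:E * second_moment pi <= overlap pi (tcons (k, w)))%E).
  apply: filterS3 (ae_tnth_neq 0 0) (ae_tnth_neq 0 k) (ae_tnth_neq 0 (- k)) => x.
  have [h [z ->]] := tconsP x; rewrite tnth_tcons0 => h0 hk hNk.
  rewrite ltNge; apply/negP => Mh.
  have /eqP := overlap_attained_norm_unique mpi pi0 dec piE pin0 Moo h0 k0 Mh Mk.
  by rewrite eqr_norm2 (negbTE hk) (negbTE hNk).
apply: filterS (ae_tnth_neq 0 0) => x.
have [h [z ->]] := tconsP x; rewrite tnth_tcons0 => h0.
by rewrite ltNge; apply/negP => Mh; apply: nex; exists h, z.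
Qed.

(** * The Metropolis--Hastings transition *)
Section transition.
Context {R : realType} {d : nat}.
Variables pi phi : d.-tuple R -> R.
Hypothesis mpi : measurable_fun setT pi.
Hypothesis pi0 : forall x, 0 <= pi x.
Hypothesis mphi : measurable_fun setT phi.
Hypothesis phi0 : forall x, 0 <= phi x.
Hypothesis phi1 : (\int[lebesgue_tuple d]_x (phi x)%:E = 1)%E.
Hypothesis phi_sym : forall z, phi (topp z) = phi z.
Local Notation lam := (@lebesgue_tuple R d).
Local Notation acc := (acceptance pi phi).
Local Notation prop := (proposal phi).

(** By [pi_accept_density] this is pi(x) q(x, y) alpha(x, y), the joint density
    of a stationary state and the accepted proposal from it; this form makes
    detailed balance visible. *)
Definition move_density (x y : d.-tuple R) : R :=
  phi (tsub y x) * Num.min (pi x) (pi y).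

Lemma topp_tsub (x y : d.-tuple R) : topp (tsub x y) = tsub y x.
Proof. by apply: eq_from_tnth => i; rewrite !tnth_mktuple opprB. Qed.

Lemma proposal_sym x y : prop y x = prop x y.
Proof. by rewrite /proposal -topp_tsub phi_sym. Qed.

Lemma move_density_sym x y : move_density x y = move_density y x.
Proof. by rewrite /move_density -topp_tsub phi_sym minC. Qed.

Lemma move_density_ge0 x y : 0 <= move_density x y.
Proof. by rewrite mulr_ge0 ?le_min ?pi0. Qed.

Lemma pi_accept_density x y : pi x * (prop x y * acc x y) = move_density x y.
Proof.
rewrite /acceptance (proposal_sym x y) /move_density -/(proposal phi x y).
have p0 : 0 <= prop x y by exact: phi0.
case: ifPn => [xy|].
  have [x0 y0] : 0 < pi x /\ 0 < prop x y.
    by split; rewrite lt0r ?pi0 ?p0 andbT; apply: contraTneq xy => ->;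
      rewrite ?mul0r ?mulr0 ltxx.
  have -> : pi y * prop x y / (pi x * prop x y) = pi y / pi x.
    by field; rewrite !gt_eqF.
  rewrite mulrCA; congr (_ * _); rewrite minr_pMr//.
  by rewrite mulr1 mulrC divfK// gt_eqF.
rewrite -leNgt => xy.
have /eqP : pi x * prop x y = 0 by apply/eqP; rewrite eq_le xy mulr_ge0 ?pi0.
rewrite mulr1 mulf_eq0 => /orP[/eqP px|/eqP ->]; last by rewrite mulr0 mul0r.
by rewrite px mul0r (min_idPl (pi0 y)) mulr0.
Qed.

Lemma acceptance_ge0 x y : 0 <= acc x y.
Proof.
rewrite /acceptance; case: ifPn => // xy.
by rewrite le_min ler01/= divr_ge0 ?mulr_ge0 ?pi0//; exact: phi0.
Qed.

Lemma acceptance_le1 x y : acc x y <= 1.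
Proof. by rewrite /acceptance; case: ifPn => // xy; rewrite ge_min lexx. Qed.

Local Notation T2 := (d.-tuple R * d.-tuple R)%type.

Lemma measurable_proposal :
  measurable_fun setT (fun xy : T2 => prop xy.1 xy.2).
Proof. by apply: measurableT_comp => //; exact: measurable_tsub. Qed.

Lemma measurable_proposal_swap :
  measurable_fun setT (fun xy : T2 => prop xy.2 xy.1).
Proof. by apply: measurableT_comp => //; exact: measurable_tsub. Qed.

Lemma measurable_pi1 : measurable_fun setT (fun xy : T2 => pi xy.1).
Proof. by apply: measurableT_comp => //; exact: measurable_fst. Qed.

Lemma measurable_pi2 : measurable_fun setT (fun xy : T2 => pi xy.2).
Proof. by apply: measurableT_comp => //; exact: measurable_snd. Qed.

Lemma measurable_move_density :
  measurable_fun setT (fun xy : T2 => move_density xy.1 xy.2).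
Proof.
apply: measurable_funM; first exact: measurable_proposal.
by apply: measurable_minr; [exact: measurable_pi1|exact: measurable_pi2].
Qed.

(** The inverse is handled as a real power with exponent -1, which agrees with
    it on nonnegative numbers, zero included. *)
Lemma measurable_acceptance :
  measurable_fun setT (fun xy : T2 => acc xy.1 xy.2).
Proof.
have m1 : measurable_fun setT (fun xy : T2 => pi xy.1 * prop xy.1 xy.2).
  by apply: measurable_funM; [exact: measurable_pi1|exact: measurable_proposal].
apply: measurable_fun_ifT => //.
- by apply: measurable_fun_ltr => //; exact: measurable_cst.
- apply: measurable_minr => //; apply: measurable_funM.
    by apply: measurable_funM; [exact: measurable_pi2|exact: measurable_proposal_swap].
  rewrite (_ : (fun _ => _) =
      (@powR R ^~ (-1)) \o (fun xy : T2 => pi xy.1 * prop xy.1 xy.2)).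
    by apply: measurableT_comp => //; exact: measurable_powR.
  by apply/funext => xy /=; rewrite powR_inv1// mulr_ge0//; exact: phi0.
Qed.

Definition accept_density (x y : d.-tuple R) := prop x y * acc x y.
Definition reject_density (x y : d.-tuple R) := prop x y * (1 - acc x y).

Local Open Scope ereal_scope.

Definition rejection x := \int[lam]_y (reject_density x y)%:E.

Lemma accept_density_ge0 x y : (0 <= accept_density x y)%R.
Proof. by rewrite mulr_ge0 ?acceptance_ge0//; exact: phi0. Qed.

Lemma reject_density_ge0 x y : (0 <= reject_density x y)%R.
Proof. by rewrite mulr_ge0 ?subr_ge0 ?acceptance_le1//; exact: phi0. Qed.

Lemma measurable_accept_density :
  measurable_fun setT (fun xy : T2 => accept_density xy.1 xy.2).
Proof.
by apply: measurable_funM; [exact: measurable_proposal|exact: measurable_acceptance].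
Qed.

Lemma measurable_reject_density :
  measurable_fun setT (fun xy : T2 => reject_density xy.1 xy.2).
Proof.
apply: measurable_funM; first exact: measurable_proposal.
by apply: measurable_funB => //; exact: measurable_acceptance.
Qed.

Lemma measurable_section1 (F : T2 -> R) x :
  measurable_fun setT F -> measurable_fun setT (fun y => F (x, y)).
Proof.
by move=> mF; apply: measurableT_comp => //; exact: measurable_pair1.
Qed.

Lemma rejection_ge0 x : 0 <= rejection x.
Proof. by apply: ge0_integral_real => y; exact: reject_density_ge0. Qed.

Lemma measurable_rejection : measurable_fun setT rejection.
Proof.
apply: (measurable_fun_fubini_tonelli_F (m2 := lam)
  (fun xy : T2 => (reject_density xy.1 xy.2)%:E)).
  by apply/measurable_EFinP; exact: measurable_reject_density.
by move=> x; rewrite lee_fin reject_density_ge0.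
Qed.

Lemma accept_reject x :
  \int[lam]_y (accept_density x y)%:E + rejection x = 1.
Proof.
rewrite /rejection -ge0_integralD_real.
- transitivity (\int[lam]_y (phi (tadd y (topp x)))%:E).
    apply: eq_integral => y _; rewrite -mulrDr addrC subrK mulr1.
    congr (phi _)%:E; apply: eq_from_tnth => i.
    by rewrite !tnth_mktuple.
  rewrite (@ge0_integral_tadd _ _ (topp x) (fun y => (phi y)%:E))//.
  exact/measurable_EFinP.
- exact: (measurable_section1 x measurable_accept_density).
- by move=> y; exact: accept_density_ge0.
- exact: (measurable_section1 x measurable_reject_density).
- by move=> y; exact: reject_density_ge0.
Qed.

Lemma rwmh_kernelE x B : measurable B -> rwmh_kernel pi phi x B =
  \int[lam]_y (accept_density x y * \1_B y)%:E + rejection x * (\1_B x)%:E.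
Proof.
move=> mB; rewrite /rwmh_kernel diracE indicE; congr (_ + _ * _).
rewrite integral_mkcond; apply: eq_integral => y _.
by rewrite patchE indicE; case: ifPn => _; rewrite ?mulr1 ?mulr0.
Qed.

Lemma pi_rwmh_kernel x B : measurable B -> (pi x)%:E * rwmh_kernel pi phi x B =
  \int[lam]_y (move_density x y * \1_B y)%:E
  + (pi x)%:E * rejection x * (\1_B x)%:E.
Proof.
move=> mB; rewrite rwmh_kernelE// ge0_muleDr; last 2 first.
- by apply: ge0_integral_real => y; apply: mulr_ge0; rewrite ?accept_density_ge0 ?indicE.
- by apply: mule_ge0; rewrite ?rejection_ge0 ?lee_fin ?indicE.
rewrite muleA -ge0_integralZl_real//.
- congr (_ + _); apply: eq_integral => y _.
  by rewrite -pi_accept_density /accept_density !mulrA.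
- apply: measurable_funM; last exact: measurable_indic.
  exact: (measurable_section1 x measurable_accept_density).
- by move=> y; apply: mulr_ge0; rewrite ?accept_density_ge0 ?indicE.
Qed.

Lemma measurable_rwmh_kernel B : measurable B ->
  measurable_fun setT (fun x => rwmh_kernel pi phi x B).
Proof.
move=> mB; under eq_fun do rewrite rwmh_kernelE//.
apply: emeasurable_funD; last first.
  apply: emeasurable_funM; first exact: measurable_rejection.
  by apply/measurable_EFinP; exact: measurable_indic.
apply: (measurable_fun_fubini_tonelli_F (m2 := lam)
  (fun xy : T2 => (accept_density xy.1 xy.2 * \1_B xy.2)%:E)).
  apply/measurable_EFinP; apply: measurable_funM.
    exact: measurable_accept_density.
  by apply: measurableT_comp => //; exact: measurable_snd.
by move=> x; rewrite lee_fin mulr_ge0 ?accept_density_ge0// indicE.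
Qed.

Lemma rwmh_kernel_ge0 x B : measurable B -> 0 <= rwmh_kernel pi phi x B.
Proof.
move=> mB; rewrite rwmh_kernelE// adde_ge0//.
  by apply: ge0_integral_real => y; apply: mulr_ge0; rewrite ?accept_density_ge0 ?indicE.
by apply: mule_ge0; rewrite ?rejection_ge0 ?lee_fin ?indicE.
Qed.

End transition.

(** * The joint law of two consecutive states *)
Lemma integral_mkcond_indic dd (T : measurableType dd) (R : realType)
    (mu : {measure set T -> \bar R}) (A : set T) (f : T -> \bar R) :
  (\int[mu]_(x in A) f x = \int[mu]_x ((\1_A x)%:E * f x))%E.
Proof.
rewrite integral_mkcond; apply: eq_integral => x _.
by rewrite patchE indicE; case: ifPn => _; rewrite ?mul1e ?mul0e.
Qed.

Section chain.
Context {R : realType} {d : nat} (pi phi : d.-tuple R -> R).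
Context {disp : measure_display} {T : measurableType disp}.
Variables (P : probability T R) (X : nat -> {RV P >-> d.-tuple R}).
Hypothesis mpi : measurable_fun setT pi.
Hypothesis pi0 : forall x, 0 <= pi x.
Hypothesis mphi : measurable_fun setT phi.
Hypothesis phi0 : forall x, 0 <= phi x.
Hypothesis phi1 : (\int[lebesgue_tuple d]_x (phi x)%:E = 1)%E.
Hypothesis phi_sym : forall z, phi (topp z) = phi z.
Hypothesis X0pi : has_density (X 0%N) pi.
Hypothesis HX : is_rwmh_chain pi phi X.
Local Notation lam := (@lebesgue_tuple R d).
Local Notation T2 := (d.-tuple R * d.-tuple R)%type.
Local Notation p := (move_density pi phi).
Local Notation rej := (rejection pi phi).
Local Open Scope ereal_scope.

Lemma integral_has_density (Y : {RV P >-> d.-tuple R}) (h : d.-tuple R -> \bar R) :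
  has_density Y pi -> measurable_fun setT h -> (forall x, 0 <= h x) ->
  \int[P]_w h (Y w) = \int[lam]_x (h x * (pi x)%:E).
Proof.
move=> Ypi mh h0.
rewrite -(ge0_integral_density (nu := distribution P Y) mpi pi0 _ mh h0).
  by rewrite ge0_integral_distribution.
exact: Ypi.
Qed.

Let mp : measurable_fun setT (fun xy : T2 => (p xy.1 xy.2)%:E).
Proof. by apply/measurable_EFinP; exact: measurable_move_density. Qed.

Let p0 (xy : T2) : 0 <= (p xy.1 xy.2)%:E.
Proof. by rewrite lee_fin move_density_ge0. Qed.

Let mstay : measurable_fun setT (fun x => (pi x)%:E * rej x).
Proof.
apply: emeasurable_funM; first exact/measurable_EFinP.
exact: measurable_rejection.
Qed.

Let stay0 x : 0 <= (pi x)%:E * rej x.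
Proof. by rewrite mule_ge0 ?lee_fin ?rejection_ge0. Qed.

Let mdiag : measurable_fun setT (fun x : d.-tuple R => (x, x)).
Proof. by apply/measurable_fun_pairP; split; exact: measurable_id. Qed.

Let mjoint : measurable_fun setT (fun w => (X 0%N w, X 1%N w)).
Proof. by apply/measurable_fun_pairP; split; exact: measurable_funPT. Qed.

Definition joint : {measure set T2 -> \bar R} :=
  image_measure P mjoint.
(** The joint law splits into an absolutely continuous part, from the accepted
   moves, and a part carried by the diagonal, from the rejections. *)
Definition joint_moved : {measure set T2 -> \bar R} :=
  density_measure (lam \x lam) mp p0.
Definition joint_stayed : {measure set T2 -> \bar R} :=
  image_measure (density_measure lam mstay stay0) mdiag.

Let mpB x (B : set (d.-tuple R)) : measurable B ->
  measurable_fun setT (fun y => p x y * \1_B y)%R.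
Proof.
move=> mB; apply: measurable_funM; last exact: measurable_indic.
exact: (measurable_section1 x (measurable_move_density mpi mphi)).
Qed.

Let pB0 x (B : set (d.-tuple R)) y : (0 <= p x y * \1_B y)%R.
Proof. by apply: mulr_ge0; rewrite ?move_density_ge0 ?indicE. Qed.

Lemma joint_moved_rectangle A B : measurable A -> measurable B ->
  joint_moved (A `*` B) =
  \int[lam]_x ((\1_A x)%:E * \int[lam]_y (p x y * \1_B y)%:E).
Proof.
move=> mA mB.
transitivity (\int[lam \x lam]_xy ((\1_(A `*` B) xy)%:E * (p xy.1 xy.2)%:E)).
  exact: integral_mkcond_indic.
rewrite fubini_tonelli1; last 2 first.
- apply: emeasurable_funM => //.
  apply/measurable_EFinP; apply: measurable_indic; exact: measurableX.
- by move=> x; rewrite mule_ge0.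
apply: eq_integral => x _; rewrite /fubini_F -ge0_integralZl//=; last 2 first.
- by apply/measurable_EFinP; exact: mpB.
- by move=> y _; rewrite lee_fin.
apply: eq_integral => y _; rewrite -!EFinM; congr EFin.
by rewrite !indicE in_setX/= -mulnb natrM; ring.
Qed.

Lemma joint_stayed_rectangle A B : measurable A -> measurable B ->
  joint_stayed (A `*` B) =
  \int[lam]_x ((\1_A x)%:E * ((pi x)%:E * rej x * (\1_B x)%:E)).
Proof.
move=> mA mB; transitivity (\int[lam]_x
    ((\1_((fun x => (x, x)) @^-1` (A `*` B)) x)%:E * ((pi x)%:E * rej x))).
  exact: integral_mkcond_indic.
apply: eq_integral => x _.
rewrite [RHS]muleCA [RHS]muleC; congr (_ * _).
rewrite -EFinM !indicE -natrM mulnb; congr (1 *+ nat_of_bool _)%R%:E.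
by apply/idP/andP; rewrite !inE.
Qed.

Lemma joint_rectangle A B : measurable A -> measurable B ->
  joint (A `*` B) = (measure_add joint_moved joint_stayed) (A `*` B).
Proof.
move=> mA mB; rewrite measure_addE joint_moved_rectangle// joint_stayed_rectangle//.
have -> : joint (A `*` B) =
    \int[P]_(w in X 0%N @^-1` A) rwmh_kernel pi phi (X 0%N w) B.
  apply: HX => //; apply: sub_sigma_algebra.
  by rewrite big_ord_recl big_ord0 setU0; exists A => //; rewrite setTI.
rewrite integral_mkcond_indic.
have mK := measurable_rwmh_kernel mpi pi0 mphi phi0 mB.
have K0 x : 0 <= rwmh_kernel pi phi x B by exact: rwmh_kernel_ge0.
have mI (C : set (d.-tuple R)) : measurable C ->
    measurable_fun setT (fun x => (\1_C x)%:E : \bar R).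
  by move=> mC; apply/measurable_EFinP; exact: measurable_indic.
have I0 (C : set (d.-tuple R)) x : 0 <= (\1_C x)%:E :> \bar R by rewrite lee_fin.
rewrite (_ : \int[P]_x _ =
    \int[P]_w ((\1_A (X 0%N w))%:E * rwmh_kernel pi phi (X 0%N w) B)) //.
rewrite (integral_has_density
  (h := fun x => (\1_A x)%:E * rwmh_kernel pi phi x B))//; last 2 first.
- by apply: emeasurable_funM => //; exact: mI.
- by move=> x; rewrite mule_ge0.
rewrite -ge0_integralD//.
- apply: eq_integral => x _; rewrite -muleA [X in _ * X]muleC pi_rwmh_kernel//.
  by rewrite ge0_muleDr ?ge0_integral_real// mule_ge0 ?lee_fin.
- by move=> x _; rewrite mule_ge0 ?lee_fin// ge0_integral_real.
- apply: emeasurable_funM; first exact: mI.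
  apply: (measurable_fun_fubini_tonelli_F (m2 := lam)
    (fun xy : T2 => (p xy.1 xy.2 * \1_B xy.2)%:E)).
    apply/measurable_EFinP; apply: measurable_funM.
      exact: measurable_move_density.
    by apply: measurableT_comp => //; exact: measurable_snd.
  by move=> xy; rewrite lee_fin.
- by move=> x _; rewrite mule_ge0 ?lee_fin// mule_ge0.
- apply: emeasurable_funM; first exact: mI.
  by apply: emeasurable_funM => //; exact: mI.
Qed.

Lemma joint_split C : measurable C ->
  joint C = (measure_add joint_moved joint_stayed) C.
Proof.
move=> mC; apply: (measure_eq_rectangles _ joint_rectangle) => //.
by rewrite (_ : joint setT = P setT) // probability_setT ltry.
Qed.

(** Functions vanishing on the diagonal do not see the rejections. *)
Lemma integral_joint (F : T2 -> \bar R) : measurable_fun setT F ->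
  (forall xy, 0 <= F xy) -> (forall x, F (x, x) = 0) ->
  \int[P]_w F (X 0%N w, X 1%N w) =
  \int[lam]_x \int[lam]_y (F (x, y) * (p x y)%:E).
Proof.
move=> mF F0 Fdiag.
transitivity (\int[joint]_xy F xy).
  by rewrite (ge0_integral_image_measure P mjoint).
rewrite (eq_measure_integral (measure_add joint_moved joint_stayed)); last first.
  by move=> C mC _; exact: joint_split.
rewrite ge0_integral_measure_add//.
rewrite (ge0_integral_image_measure _ mdiag)//.
rewrite [X in _ + X]integral0_eq; last by move=> x _; rewrite Fdiag.
rewrite adde0.
rewrite (ge0_integral_density (mu := lam \x lam)
  (f := fun xy : T2 => p xy.1 xy.2))//.
- rewrite fubini_tonelli1//; first exact: emeasurable_funM.
  by move=> x; rewrite mule_ge0.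
- exact: measurable_move_density.
Qed.

Lemma move_stay x :
  \int[lam]_y (p x y)%:E + (pi x)%:E * rej x = (pi x)%:E.
Proof.
transitivity ((pi x)%:E * (\int[lam]_y (accept_density pi phi x y)%:E + rej x)).
  have a0 : 0 <= \int[lam]_y (accept_density pi phi x y)%:E.
    by apply: ge0_integral_real => y; exact: accept_density_ge0.
  have r0 : 0 <= rej x by exact: rejection_ge0.
  rewrite [RHS]ge0_muleDr//.
  congr (_ + _); rewrite -ge0_integralZl_real//.
  - by apply: eq_integral => y _; rewrite -pi_accept_density.
  - by apply: (measurable_section1 x (measurable_accept_density mpi pi0 mphi phi0)).
  - by move=> y; exact: accept_density_ge0.
by rewrite accept_reject// mule1.
Qed.

(** Detailed balance: exchanging the two variables in the symmetric density of
    accepted moves turns the mass flowing into B into the mass flowing out of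
    it, and the latter together with the rejected mass in B is the integral of
    pi over B by [move_stay]. *)
Lemma has_density_step : has_density (X 1%N) pi.
Proof.
move=> B mB.
transitivity (joint (setT `*` B)).
  by rewrite /distribution /joint /image_measure /pushforward; congr (P _);
    apply/seteqP; split => [w|w []].
rewrite joint_rectangle// measure_addE.
have -> : joint_moved (setT `*` B) = \int[lam]_x \int[lam]_y (p x y * \1_B y)%:E.
  rewrite joint_moved_rectangle//.
  by apply: eq_integral => x _; rewrite indicT mul1e.
have -> : joint_stayed (setT `*` B) =
    \int[lam]_x ((\1_B x)%:E * ((pi x)%:E * rej x)).
  rewrite joint_stayed_rectangle//.
  by apply: eq_integral => x _; rewrite indicT mul1e muleC.
rewrite [RHS]integral_mkcond_indic.
have mpxy : measurable_fun setT (fun xy : T2 => (p xy.1 xy.2 * \1_B xy.2)%:E).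
  apply/measurable_EFinP; apply: measurable_funM.
    exact: measurable_move_density.
  by apply: measurableT_comp => //; exact: measurable_snd.
rewrite (fubini_tonelli (fun xy : T2 => (p xy.1 xy.2 * \1_B xy.2)%:E))//; last first.
  by move=> xy; rewrite lee_fin.
rewrite -ge0_integralD//; last 4 first.
- by move=> y _; apply: integral_ge0 => x _; rewrite lee_fin.
- apply: (measurable_fun_fubini_tonelli_G (m1 := lam)
    (fun xy : T2 => (p xy.1 xy.2 * \1_B xy.2)%:E)) => //.
  by move=> xy; rewrite lee_fin.
- by move=> y _; rewrite mule_ge0 ?lee_fin.
- apply: emeasurable_funM => //.
  by apply/measurable_EFinP; exact: measurable_indic.
apply: eq_integral => y _ /=; rewrite -[in RHS](move_stay y) [RHS]ge0_muleDr//; last first.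
  by apply: ge0_integral_real => z; exact: move_density_ge0.
congr (_ + _); rewrite -ge0_integralZl_real//.
- by apply: eq_integral => x _; rewrite move_density_sym// mulrC.
- exact: (measurable_section1 y (measurable_move_density mpi mphi)).
- by move=> z; exact: move_density_ge0.
Qed.

(** The substitution y = x + z and Fubini. *)
Lemma integral_jump :
  \int[P]_w (sqnorm (tsub (X 1%N w) (X 0%N w)))%:E =
  \int[lam]_z ((phi z)%:E * overlap pi z).
Proof.
have mF : measurable_fun setT (fun xy : T2 => (sqnorm (tsub xy.2 xy.1))%:E).
  by apply/measurable_EFinP/measurable_sqnorm; exact: measurable_tsub.
rewrite (integral_joint mF); last 2 first.
- by move=> xy; rewrite lee_fin sqnorm_ge0.
- move=> x /=; congr EFin; apply: big1 => i _.
  by rewrite tnth_mktuple subrr expr0n.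
pose g (x z : d.-tuple R) := 
  (phi z * (sqnorm z * Num.min (pi x) (pi (tadd x z))))%R.
have g0 x z : (0 <= g x z)%R.
  by rewrite mulr_ge0// mulr_ge0 ?sqnorm_ge0// le_min !pi0.
have mmin : measurable_fun setT (fun xz : T2 =>
    Num.min (pi xz.1) (pi (tadd xz.1 xz.2))).
  apply: measurable_minr; first exact: measurable_pi1.
  by apply: measurableT_comp => //; exact: measurable_tadd.
have mg : measurable_fun setT (fun xz : T2 => (g xz.1 xz.2)%:E).
  apply/measurable_EFinP; apply: measurable_funM.
    by apply: measurableT_comp => //; exact: measurable_snd.
  by apply: measurable_funM => //; apply: measurable_sqnorm; exact: measurable_snd.
transitivity (\int[lam]_x \int[lam]_z (g x z)%:E).
  apply: eq_integral => x _.
  rewrite -(ge0_integral_tadd x); last 2 first.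
  - apply: emeasurable_funM.
      by apply/measurable_EFinP; exact: (measurable_section1 x (measurable_sqnorm
        (measurable_tsub measurable_snd measurable_fst))).
    by apply/measurable_EFinP; exact: (measurable_section1 x (measurable_move_density mpi mphi)).
  - by move=> y; rewrite mule_ge0 ?lee_fin ?sqnorm_ge0 ?move_density_ge0.
  apply: eq_integral => z _ /=; rewrite -EFinM; congr EFin.
  have -> : tsub (tadd z x) x = z.
    by apply: eq_from_tnth => i; rewrite !tnth_mktuple addrK.
  rewrite /move_density /g; have -> : tsub (tadd z x) x = z.
    by apply: eq_from_tnth => i; rewrite !tnth_mktuple addrK.
  have -> : tadd z x = tadd x z.
    by apply: eq_from_tnth => i; rewrite !tnth_mktuple addrC.
  by rewrite mulrCA.
rewrite (fubini_tonelli (fun xz : T2 => (g xz.1 xz.2)%:E))//; last first.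
  by move=> xz; rewrite lee_fin.
apply: eq_integral => z _ /=; rewrite /overlap.
have mm : measurable_fun setT (fun x => Num.min (pi x) (pi (tadd x z))).
  apply: measurable_minr => //; apply: measurableT_comp => //.
  by apply: measurable_tadd => //; exact: measurable_cst.
have m0 x : (0 <= Num.min (pi x) (pi (tadd x z)))%R by rewrite le_min !pi0.
rewrite -ge0_integralZl_real ?sqnorm_ge0//.
rewrite -ge0_integralZl_real//; first exact: measurable_funM.
by move=> x; rewrite mulr_ge0 ?sqnorm_ge0.
Qed.

End chain.

(** * Averaging over the proposal *)
Section mean_jump.
Context {R : realType} {n : nat} (pi phi : n.+1.-tuple R -> R) (pihat : R -> R).
Hypothesis mpi : measurable_fun setT pi.
Hypothesis pi0 : forall x, 0 <= pi x.
Hypothesis dec : forall r s, 0 <= r -> r <= s -> pihat s <= pihat r.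
Hypothesis piE : forall x, pi x = pihat (enorm x).
Hypothesis mphi : measurable_fun setT phi.
Hypothesis phi0 : forall x, 0 <= phi x.
Hypothesis phi1 : (\int[lebesgue_tuple n.+1]_x (phi x)%:E = 1)%E.
Hypothesis pi_neq0 : (\int[lebesgue_tuple n.+1]_x (pi x)%:E <> 0)%E.
Hypothesis Moo : (second_moment pi < +oo)%E.
Local Notation lam := (@lebesgue_tuple R n.+1).
Local Open Scope ereal_scope.

Let min0 x z : (0 <= Num.min (pi x) (pi (tadd x z)))%R.
Proof. by rewrite le_min !pi0. Qed.

Lemma overlap_ge0 z : 0 <= overlap pi z.
Proof. by rewrite mule_ge0 ?lee_fin ?sqnorm_ge0// ge0_integral_real. Qed.

Lemma measurable_overlap : measurable_fun setT (overlap pi).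
Proof.
apply: emeasurable_funM.
  by apply/measurable_EFinP; apply: measurable_sqnorm; exact: measurable_id.
apply: (measurable_fun_fubini_tonelli_G (m1 := lam)
  (fun xz : n.+1.-tuple R * n.+1.-tuple R =>
    (Num.min (pi xz.1) (pi (tadd xz.1 xz.2)))%:E)).
  apply/measurable_EFinP; apply: measurable_minr.
    by apply: measurableT_comp => //; exact: measurable_fst.
  by apply: measurableT_comp => //; exact: measurable_tadd.
by move=> x; rewrite lee_fin.
Qed.

(** A strict inequality almost everywhere stays strict after averaging against
    the probability density phi. *)
Lemma mean_overlap_lt :
  \int[lam]_z ((phi z)%:E * overlap pi z) < (16 / 9)%:E * second_moment pi.
Proof.
have lt_ae := overlap_lt_ae mpi pi0 dec piE pi_neq0 Moo.
have M0 := second_moment_gt0 mpi pi0 pi_neq0.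
have Mfin : second_moment pi \is a fin_num by rewrite ge0_fin_numE// ltW.
pose k : R := (16 / 9 * fine (second_moment pi))%R.
have kE : (16 / 9)%:E * second_moment pi = k%:E by rewrite [RHS]EFinM fineK.
have k0 : (0 <= k)%R by rewrite mulr_ge0// fine_ge0// ltW.
(* [overlap] may be infinite on the exceptional set; truncation at k makes it
   real and bounded everywhere and changes it on a null set only. *)
pose ov z := Num.min (fine (overlap pi z)) k.
have mov : measurable_fun setT ov.
  apply: measurable_minr => //.
  by apply: measurableT_comp => //; exact: measurable_overlap.
have ov0 z : (0 <= ov z)%R by rewrite le_min k0 fine_ge0// overlap_ge0.
have -> : \int[lam]_z ((phi z)%:E * overlap pi z) =
    \int[lam]_z (phi z * ov z)%:E.
  apply: ge0_ae_eq_integral => //.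
  - apply: emeasurable_funM; first exact/measurable_EFinP.
    exact: measurable_overlap.
  - by apply/measurable_EFinP; exact: measurable_funM.
  - by move=> z _; rewrite mule_ge0 ?lee_fin ?overlap_ge0.
  - by move=> z _; rewrite lee_fin mulr_ge0.
  apply: filterS lt_ae => z; rewrite kE => zk _.
  have zfin : overlap pi z \is a fin_num.
    by rewrite ge0_fin_numE ?overlap_ge0// (lt_trans zk) ?ltry.
  have zle : (fine (overlap pi z) <= k)%R by rewrite -lee_fin fineK// ltW.
  by rewrite EFinM /ov (min_idPl zle) fineK.
rewrite kE ltNge; apply/negP => kle.
have intk : \int[lam]_z (phi z * k)%:E = k%:E.
  under eq_integral do rewrite mulrC.
  by rewrite ge0_integralZl_real// phi1 mule1.
have fk z : (phi z * ov z <= phi z * k)%R.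
  by rewrite ler_wpM2l// ge_min lexx orbT.
have H : {ae lam, forall z, (phi z * ov z = phi z * k)%R}.
  apply: ae_eq_of_integral_le => //.
  - exact: measurable_funM.
  - exact: measurable_funM.
  - by move=> z; rewrite mulr_ge0.
  - apply: (@le_lt_trans _ _ k%:E); last exact: ltry.
    rewrite -intk; apply: ge0_le_integral_real => //.
    + exact: measurable_funM.
    + by move=> z; rewrite mulr_ge0.
    + exact: measurable_funM.
  - by rewrite intk.
have : \int[lam]_z (phi z)%:E = 0.
  apply/(ge0_integral_eq0_ae _ _ _).2.
  - exact/measurable_EFinP.
  - by move=> z; rewrite lee_fin.
  apply: filterS2 lt_ae H => z; rewrite kE => zk /eqP.
  rewrite -subr_eq0 -mulrBr mulf_eq0 => /orP[/eqP ->//|].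
  rewrite subr_eq0 /ov => /eqP/min_idPr.
  rewrite -lee_fin fineK; last first.
    by rewrite ge0_fin_numE ?overlap_ge0// (lt_trans zk) ?ltry.
  by rewrite leNgt zk.
by rewrite phi1 => /eqP; rewrite onee_eq0.
Qed.

End mean_jump.

(** * Trace covariance and conclusion *)
Section moments_of_density.
Context {R : realType} {d : nat} (pi : d.-tuple R -> R).
Context {disp : measure_display} {T : measurableType disp} (P : probability T R).
Hypothesis mpi : measurable_fun setT pi.
Hypothesis pi0 : forall x, 0 <= pi x.
Hypothesis pi_sym : forall x, pi (topp x) = pi x.
Local Notation lam := (@lebesgue_tuple R d).
Local Open Scope ereal_scope.

Let mtuple (Y : {RV P >-> d.-tuple R}) : measurable_fun setT (Y : T -> d.-tuple R).
Proof. exact: measurable_funPT. Qed.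

Lemma integral_sqnorm_has_density (Y : {RV P >-> d.-tuple R}) :
  has_density Y pi -> \int[P]_w (sqnorm (Y w))%:E = second_moment pi.
Proof.
move=> Ypi; rewrite (integral_has_density mpi pi0 (h := fun x => (sqnorm x)%:E) Ypi).
- by [].
- by apply/measurable_EFinP; apply: measurable_sqnorm; exact: measurable_id.
- by move=> x; rewrite lee_fin sqnorm_ge0.
Qed.

Hypothesis Moo : second_moment pi < +oo.

Lemma integrable_sqnorm (Y : {RV P >-> d.-tuple R}) : has_density Y pi ->
  P.-integrable setT (fun w => (sqnorm (Y w))%:E).
Proof.
move=> Ypi; apply/integrableP; split.
  by apply/measurable_EFinP; apply: measurable_sqnorm.
under eq_integral do rewrite gee0_abs ?lee_fin ?sqnorm_ge0//.
by rewrite integral_sqnorm_has_density.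
Qed.

Lemma sqr_tnth_le (x : d.-tuple R) i : (tnth x i ^+ 2 <= sqnorm x)%R.
Proof.
rewrite /sqnorm (bigD1 i)//= lerDl; apply: sumr_ge0 => j _; exact: sqr_ge0.
Qed.

Lemma integrable_tnthM (Y Z : {RV P >-> d.-tuple R}) i :
  has_density Y pi -> has_density Z pi ->
  P.-integrable setT (fun w => (tnth (Y w) i * tnth (Z w) i)%:E).
Proof.
move=> Ypi Zpi.
apply: le_integrable (integrableD measurableT (integrable_sqnorm Ypi) (integrable_sqnorm Zpi)) => //.
  by apply/measurable_EFinP; apply: measurable_funM; exact: measurable_tnth_comp.
move=> w _ /=; rewrite lee_fin [leRHS]ger0_norm ?addr_ge0 ?sqnorm_ge0//.
have := sqr_tnth_le (Y w) i; have := sqr_tnth_le (Z w) i.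
set a := tnth (Y w) i; set b := tnth (Z w) i => hb ha.
by rewrite ler_norml; apply/andP; split; nra.
Qed.

(** The reflection x |-> -x preserves Lebesgue measure and pi and exchanges the
    positive and negative parts of a coordinate; these have equal integrals,
    finite because |t| <= 1 + t^2. *)
Lemma mean0 (Y : {RV P >-> d.-tuple R}) i : has_density Y pi ->
  'E_P[fun w => tnth (Y w) i] = 0.
Proof.
move=> Ypi; rewrite expectation.unlock.
have mc : measurable_fun setT (fun x : d.-tuple R => (tnth x i)%:E : \bar R).
  by apply/measurable_EFinP; exact: measurable_tnth.
pose hp : d.-tuple R -> \bar R := (fun x : d.-tuple R => (tnth x i)%:E : \bar R)^\+.
pose hn : d.-tuple R -> \bar R := (fun x : d.-tuple R => (tnth x i)%:E : \bar R)^\-.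
have mhp : measurable_fun setT hp by exact: measurable_funepos.
have mhn : measurable_fun setT hn by exact: measurable_funeneg.
have hp0 x : 0 <= hp x by exact: funepos_ge0.
have hn0 x : 0 <= hn x by exact: funeneg_ge0.
have hpn x : hn x = hp (topp x).
  by rewrite /hn /hp funenegE funeposE tnth_mktuple.
have E : \int[P]_w hn (Y w) = \int[P]_w hp (Y w).
  rewrite (integral_has_density mpi pi0 Ypi mhn hn0).
  rewrite (integral_has_density mpi pi0 Ypi mhp hp0).
  rewrite -(ge0_integral_topp (F := fun x => hp x * (pi x)%:E)).
  - by apply: eq_integral => x _; rewrite hpn pi_sym.
  - by apply: emeasurable_funM => //; exact/measurable_EFinP.
  - by move=> x; rewrite mule_ge0 ?lee_fin.
rewrite integralE.
transitivity (\int[P]_w hp (Y w) - \int[P]_w hn (Y w)).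
  by congr (_ - _); apply: eq_integral => w _;
    rewrite /hp /hn ?funeposE ?funenegE.
rewrite E subee//.
rewrite ge0_fin_numE ?integral_ge0//.
apply: (@le_lt_trans _ _ (\int[P]_w (1 + sqnorm (Y w))%:E)).
  apply: ge0_le_integral => //.
  - by apply: (measurableT_comp mhp).
  - by apply/measurable_EFinP; apply: measurable_funD => //; exact: measurable_sqnorm.
  - move=> w _; rewrite /hp funeposE -fine_max//= lee_fin ge_max.
    have := sqr_tnth_le (Y w) i; set a := tnth (Y w) i => ha.
    by apply/andP; split; nra.
rewrite ge0_integralD_real//.
- rewrite integral_cst//= probability_setT mule1 integral_sqnorm_has_density//.
  by rewrite lte_add_pinfty ?ltry.
- exact: measurable_sqnorm.
- by move=> w; exact: sqnorm_ge0.
Qed.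

Lemma integrable_tdot (Y Z : {RV P >-> d.-tuple R}) :
  has_density Y pi -> has_density Z pi ->
  P.-integrable setT (fun w => (tdot (Y w) (Z w))%:E).
Proof.
move=> Ypi Zpi; rewrite (_ : (fun w => _) =
    (fun w => \sum_(i < d) (tnth (Y w) i * tnth (Z w) i)%:E)); last first.
  by apply/funext => w; rewrite sumEFin.
by apply: integrable_sum => // i _; exact: integrable_tnthM.
Qed.

Lemma trCovE (Y Z : {RV P >-> d.-tuple R}) :
  has_density Y pi -> has_density Z pi ->
  trCov Y Z = \int[P]_w (tdot (Y w) (Z w))%:E.
Proof.
move=> Ypi Zpi; rewrite /trCov.
transitivity (\sum_(i < d) \int[P]_w (tnth (Y w) i * tnth (Z w) i)%:E).
  apply: eq_bigr => i _.
  rewrite covariance.unlock !mean0//= expectation.unlock.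
  apply: eq_integral => w _; congr EFin.
  transitivity ((tnth (Y w) i - 0) * (tnth (Z w) i - 0))%R => //.
  by rewrite !subr0.
rewrite -integral_sum//.
- by apply: eq_integral => w _; rewrite sumEFin.
- by move=> i; exact: integrable_tnthM.
Qed.

Lemma trVarE (Y : {RV P >-> d.-tuple R}) :
  has_density Y pi -> trVar Y = second_moment pi.
Proof.
move=> Ypi; by rewrite /trVar trCovE// -(integral_sqnorm_has_density Ypi).
Qed.

(** Expectation of 2 y.z + |z - y|^2 = |y|^2 + |z|^2, which converts a bound on
    the mean square jump into one on the trace covariance. *)
Lemma trCov_polarization (Y Z : {RV P >-> d.-tuple R}) :
  has_density Y pi -> has_density Z pi ->
  (2 : R)%:E * trCov Y Z + \int[P]_w (sqnorm (tsub (Z w) (Y w)))%:E =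
  (2 : R)%:E * second_moment pi.
Proof.
move=> Ypi Zpi.
have pol (x y : d.-tuple R) :
    (2 * tdot x y + sqnorm (tsub y x) = sqnorm x + sqnorm y)%R.
  rewrite /tdot /sqnorm mulr_sumr -!big_split/=; apply: eq_bigr => i _.
  by rewrite tnth_mktuple; ring.
have itd := integrable_tdot Ypi Zpi.
have iY := integrable_sqnorm Ypi; have iZ := integrable_sqnorm Zpi.
have ij : P.-integrable setT (fun w => (sqnorm (tsub (Z w) (Y w)))%:E).
  rewrite (_ : (fun w => _) = (fun w => (sqnorm (Y w))%:E + (sqnorm (Z w))%:E
      - (2 : R)%:E * (tdot (Y w) (Z w))%:E)).
    by apply: integrableB => //; [exact: integrableD|exact: integrableZl].
  apply/funext => w; rewrite -EFinM -EFinN -!EFinD; congr EFin.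
  by rewrite -pol addrAC subrr add0r.
rewrite trCovE// -integralZl// -integralD//; last exact: integrableZl.
transitivity (\int[P]_w ((sqnorm (Y w))%:E + (sqnorm (Z w))%:E)).
  by apply: eq_integral => w _; rewrite -EFinM -!EFinD pol.
rewrite integralD// !integral_sqnorm_has_density//.
by rewrite mule_natl mule2n.
Qed.

End moments_of_density.

Theorem corollary4p12 (R : realType) (d : nat) (pi phi : d.-tuple R -> R)
    (pihat : R -> R) (disp : measure_display) (T : measurableType disp)
    (P : probability T R) (X : nat -> {RV P >-> d.-tuple R}) :
  (1 <= d)%N ->
  is_density pi -> is_density phi ->
  is_stationary_rwmh_chain pi phi X ->
  (forall r s, 0 <= r -> r <= s -> pihat s <= pihat r) ->
  (forall x, pi x = pihat (enorm x)) ->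
  (forall z, phi (topp z) = phi z) ->
  square_integrable (X 0%N) ->
  1 / 9 < trCorr (X 0%N) (X 1%N).
Proof.
case: d pi phi X => // n pi phi X _ [mpi pi0 pi1] [mphi phi0 phi1] [X0pi chain].
move=> dec piE phi_sym X0_L2.
have X1pi := has_density_step mpi pi0 mphi phi0 phi1 phi_sym X0pi chain.
have pi_sym x : pi (topp x) = pi x.
  rewrite !piE; congr (pihat (Num.sqrt _)); apply: eq_bigr => i _.
  by rewrite tnth_mktuple sqrrN.
have pi_neq0 : (\int[lebesgue_tuple n.+1]_x (pi x)%:E <> 0)%E.
  by rewrite pi1 => /eqP; rewrite onee_eq0.
have Moo : (second_moment pi < +oo)%E.
  rewrite -(integral_sqnorm_has_density mpi pi0 X0pi).
  move: X0_L2; rewrite /square_integrable expectation.unlock.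
  by under eq_integral do rewrite enorm_sqr.
have M0 := second_moment_gt0 mpi pi0 pi_neq0.
have J := mean_overlap_lt mpi pi0 dec piE mphi phi0 phi1 pi_neq0 Moo.
have pol := trCov_polarization mpi pi0 pi_sym Moo X0pi X1pi.
rewrite (integral_jump mpi pi0 mphi phi0 phi_sym X0pi chain) in pol.
rewrite /trCorr !(trVarE mpi pi0 pi_sym Moo)// -expr2.
have Mfin : (second_moment pi \is a fin_num)%E by rewrite ge0_fin_numE// ltW.
have Cfin : (trCov (X 0%N) (X 1%N) \is a fin_num)%E.
  rewrite (trCovE mpi pi0 pi_sym Moo)//; apply: integrable_fin_num => //.
  exact: (integrable_tdot mpi pi0 Moo).
move: M0 J pol; rewrite -(fineK Mfin) -(fineK Cfin) /=.
set M := fine (second_moment pi); set C := fine (trCov _ _).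
rewrite lte_fin => M0; rewrite -!EFinM => J.
have Jfin : (\int[lebesgue_tuple n.+1]_z ((phi z)%:E * overlap pi z) \is a fin_num)%E.
  rewrite ge0_fin_numE; first by apply: lt_trans J _; exact: ltry.
  by apply: integral_ge0 => z _; rewrite mule_ge0 ?lee_fin ?overlap_ge0.
move: J; rewrite -(fineK Jfin) lte_fin -EFinD => J [pol].
rewrite sqr_sqrtr ?(ltW M0)// ltr_pdivlMr//; lra.
Qed.
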